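(* There exists a bounded non-circular domain $\Omega\subset\mathbb C^2$ with $0\in\Omega$ and with piecewise smooth boundary such that $K_p(0)=1/|\Omega|$ for all $2\le p<\infty$.
   Context: $|\cdot|$ denotes Lebesgue measure. For $0<p<\infty$, $A^p(\Omega)=\{f\in\mathcal O(\Omega):\|f\|_p^p:=\int_\Omega|f|^p<\infty\}$ and the $p$-Bergman kernel is $K_p(z):=\bigl(\inf\{\|f\|_p: f\in A^p(\Omega),\ f(z)=1\}\bigr)^{-p}$. A domain $\Omega\subset\mathbb C^n$ is circular if $\lambda z\in\Omega$ for every $z\in\Omega$ and every $\lambda\in\mathbb C$ with $|\lambda|=1$; non-circular means not circular. *)

(* Defs.v *)
From HB Require Import structures.
From mathcomp Require Import all_boot all_order all_algebra.
From mathcomp Require Import complex.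
From mathcomp Require Import all_classical all_reals all_analysis.

Set Implicit Arguments.
Unset Strict Implicit.
Unset Printing Implicit Defensive.

Import Order.TTheory GRing.Theory Num.Theory.
Import numFieldNormedType.Exports.

Local Open Scope classical_set_scope.
Local Open Scope ring_scope.
Local Open Scope complex_scope.

(* [R[i]^o] (rather than [R[i]]) carries the normed module structure over the
   field [R[i]]; hence [open], [connected], [bounded_set] on [C2 R] refer to the
   usual topology and norm, and [differentiable] to complex differentiability
   (the differential is required to be [R[i]]-linear). *)
Definition C2 (R : realType) := (R[i]^o * R[i]^o)%type.

(* The underlying real space of [C2 R]; it carries Lebesgue measure and real
   differential calculus. *)
Definition R4 (R : realType) := ((R * R) * (R * R))%type.

Definition toC2 (R : realType) (x : R4 R) : C2 R :=
  (x.1.1 +i* x.1.2, x.2.1 +i* x.2.2).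

Definition realify (R : realType) (Omega : set (C2 R)) : set (R4 R) :=
  @toC2 R @^-1` Omega.

(* The library's sigma-finite instance on [m1 \x m2] is not found by inference
   for general sigma-finite factors; it is needed to iterate products. *)
Lemma product_sigma_finite d1 d2 (T1 : measurableType d1)
    (T2 : measurableType d2) (R : realType)
    (m1 : {sigma_finite_measure set T1 -> \bar R})
    (m2 : {sigma_finite_measure set T2 -> \bar R}) :
  sigma_finite setT (m1 \x m2)%E.
Proof.
have /sigma_finiteP[F [TF ndF Foo]] := sigma_finiteT m1.
have /sigma_finiteP[G [TG ndG Goo]] := sigma_finiteT m2.
exists (fun n => F n `*` G n).
  rewrite -setXTT TF TG predeqE => -[x y]; split.
    move=> [/= [n _ Fnx] [k _ Gky]]; exists (maxn n k) => //; split.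
    - by move: x Fnx; exact/subsetPset/ndF/leq_maxl.
    - by move: y Gky; exact/subsetPset/ndG/leq_maxr.
  by move=> [n _ []/= ? ?]; split; exists n.
move=> k; have [? ?] := Foo k; have [? ?] := Goo k.
split; first exact: measurableX.
by rewrite product_measure1E// lte_mul_pinfty// ge0_fin_numE.
Qed.

Definition lebesgue2 (R : realType) :
    set (measurableTypeR R * measurableTypeR R) -> \bar R :=
  (@lebesgue_measure R \x @lebesgue_measure R)%E.
Arguments lebesgue2 R : clear implicits.
HB.instance Definition _ (R : realType) :=
  Measure.copy (lebesgue2 R) (@lebesgue_measure R \x @lebesgue_measure R)%E.
HB.instance Definition _ (R : realType) :=
  Measure_isSigmaFinite.Build _ _ _ (lebesgue2 R)
    (product_sigma_finite (@lebesgue_measure R) (@lebesgue_measure R)).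

Definition lebesgue4 (R : realType) :
    set ((measurableTypeR R * measurableTypeR R) *
         (measurableTypeR R * measurableTypeR R)) -> \bar R :=
  (lebesgue2 R \x lebesgue2 R)%E.
Arguments lebesgue4 R : clear implicits.
HB.instance Definition _ (R : realType) :=
  Measure.copy (lebesgue4 R) (lebesgue2 R \x lebesgue2 R)%E.
HB.instance Definition _ (R : realType) :=
  Measure_isSigmaFinite.Build _ _ _ (lebesgue4 R)
    (product_sigma_finite (lebesgue2 R) (lebesgue2 R)).

Definition volume (R : realType) (Omega : set (C2 R)) : R :=
  fine (lebesgue4 R (realify Omega)).

Definition domain (R : realType) (Omega : set (C2 R)) : Prop :=
  [/\ open Omega, connected Omega & Omega !=set0].

Definition circular (R : realType) (Omega : set (C2 R)) : Prop :=
  forall (z : C2 R) (lambda : R[i]),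
    Omega z -> `|lambda| = 1 -> Omega (lambda *: z).

Definition holomorphic (R : realType) (Omega : set (C2 R))
    (f : C2 R -> R[i]^o) : Prop :=
  forall z : C2 R, Omega z -> differentiable f z.

Definition integral_pow (R : realType) (Omega : set (C2 R)) (p : R)
    (f : C2 R -> R[i]^o) : \bar R :=
  (\int[lebesgue4 R]_(x in realify Omega)
     ((Normc.normc (f (toC2 x))) `^ p)%:E)%E.

Definition pnorm (R : realType) (Omega : set (C2 R)) (p : R)
    (f : C2 R -> R[i]^o) : R :=
  (fine (integral_pow Omega p f)) `^ p^-1.

Definition bergman_space (R : realType) (Omega : set (C2 R)) (p : R) :
    set (C2 R -> R[i]^o) :=
  [set f | holomorphic Omega f /\ (integral_pow Omega p f < +oo)%E].

(* If no competitor exists, the infimum is [+oo] on paper and [0] here; as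
   [0 `^ (- p) = 0] for [p != 0], the kernel vanishes under both readings. If
   competitors exist and [z] is in the open set [Omega], the infimum is positive
   by the sub-mean value property of [`|f| `^ p]. *)
Definition bergman_kernel (R : realType) (Omega : set (C2 R)) (p : R)
    (z : C2 R) : R :=
  (inf [set pnorm Omega p f |
         f in [set f | bergman_space Omega p f /\ f z = 1]]) `^ (- p).

(* [k] times continuously differentiable on the open set [U], for functions on
   a finite-dimensional space. *)
Fixpoint class_C (R : realType) (V : normedModType R) (k : nat) (U : set V)
    (f : V -> R) : Prop :=
  (forall x, U x -> {for x, continuous f}) /\
  (if k is k'.+1 then
     forall v : V, (forall x, U x -> derivable f x v) /\ class_C k' U ('D_v f)
   else True).

Definition smooth_on (R : realType) (V : normedModType R) (U : set V)
    (f : V -> R) : Prop :=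
  forall k, class_C k U f.

Definition linearly_independent (R : realType) (V : normedModType R) (k : nat)
    (phi : 'I_k -> V -> R) : Prop :=
  forall c : 'I_k -> R,
    (forall v, \sum_(j < k) c j * phi j v = 0) -> forall j, c j = 0.

Definition boundary (T : topologicalType) (A : set T) : set T :=
  closure A `\` interior A.

(* Near each boundary point, [D] is cut out by finitely many smooth inequalities
   [rho j < 0] whose zero sets pass through that point and are transversal
   there; [k = 1] is the case of a smooth boundary point. *)
Definition piecewise_smooth_boundary (R : realType) (V : normedModType R)
    (D : set V) : Prop :=
  forall x : V, boundary D x ->
    exists (U : set V) (k : nat) (rho : 'I_k -> V -> R),
      [/\ open U /\ U x,
          forall j, smooth_on U (rho j) /\ rho j x = 0,
          linearly_independent (fun j => 'd (rho j) x : V -> R) &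
          D `&` U = [set y | U y /\ forall j, rho j y < 0]].

(* Main.v *)
Require Import Defs.
From HB Require Import structures.
From mathcomp Require Import all_boot all_order all_algebra.
From mathcomp Require Import complex ring lra.
From mathcomp Require Import all_classical all_reals all_analysis.
From mathcomp Require Import measurable_realfun.

Set Implicit Arguments.
Unset Strict Implicit.
Unset Printing Implicit Defensive.

Import Order.TTheory GRing.Theory Num.Theory.
Import numFieldNormedType.Exports.

Local Open Scope classical_set_scope.
Local Open Scope ring_scope.

(** The domain is the image of the unit ball of C^2 under the volume-preserving
    shear (z1, w) |-> (z1, w + z1^2),
      Omega = { |z1|^2 + |z2 - z1^2|^2 < 1 }.
    Scalar multiplication by -1 does not preserve it, but the weighted action
    l . (z1, z2) = (l z1, l^2 z2) multiplies the two summands by |l|^2 and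
    |l|^4, so Omega is stable under |l| <= 1 ([quasi_ball_weighted_act]). This
    makes it connected, and since the dilations with l > 0 cross the boundary at
    nonzero speed, the boundary is a smooth hypersurface
    ([piecewise_smooth_quasi_ball]).

    The constant 1 gives K_p(0) >= 1/|Omega|. For the converse let f be
    holomorphic on Omega with f(0) = 1. For z in Omega the function
    g(l) = f(l . z) is complex differentiable on the closed unit disc and
    g(0) = 1, so Re g has mean 1 on the unit circle; as
    |w|^p >= 1 + p (Re w - 1), the mean of |g|^p is at least 1
    ([circle_sub_mean_value]). For |l| = 1 the action is a pair of plane
    rotations, which preserve Lebesgue measure; averaging the integral of |f|^p
    over the circle and exchanging the integrals thus bounds it below by |Omega|
    ([circle_average_le], [volume_le_integral_pow]).

    Two classical facts are established on the way. Invariance of planar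
    Lebesgue measure under rotations comes from writing a rotation as three
    shears, each of which is a family of one-dimensional translations
    ([integral_rotation]). The mean value property is Goursat's theorem on a
    rectangle, in a form which needs differentiability at each point but no
    continuity of the derivative ([goursat]), applied to h(s + it) = g(e^(s+it)):
    the horizontal sides cancel by periodicity, so the mean of h(s + i.) is
    independent of s <= 0, and it tends to g(0) as s -> -oo
    ([circle_mean_value]). *)

(** * Invariance of Lebesgue measure under rotations *)

Section rotation_invariance.
Variable R : realType.
Local Notation mR := (measurableTypeR R).
Local Notation mu := (@lebesgue_measure R).

Lemma measurable_addr (a : R) : measurable_fun [set: mR] (fun x : mR => (x + a : mR)).
Proof. exact: measurable_funD. Qed.

(** Both sides are measures agreeing on half-open intervals, hence everywhere. *)
Lemma lebesgue_measure_translation (a : R) (A : set mR) : measurable A ->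
  mu A = pushforward mu (fun x : mR => (x + a : mR)) A.
Proof.
move=> mA.
pose T := HB.pack_for {mfun mR >-> mR} (fun x : mR => (x + a : mR))
   (isMeasurableFun.Build _ _ _ _ _ (measurable_addr a)).
rewrite -[RHS]/(pushforward mu T A).
apply: lebesgue_measure_unique => // X [[b c] _ <-].
rewrite -[RHS]/(mu (T @^-1` `]b, c]%classic)).
have -> : T @^-1` `]b, c] = `]b - a, c - a]%classic.
  by apply/seteqP; split => x /=; rewrite !in_itv/= ltrBlDr lerBrDr.
rewrite /= !lebesgue_measure_itv/=.
rewrite !lte_fin ltrD2r; case: ifPn => // _.
by rewrite -!EFinD; congr EFin; ring.
Qed.

Lemma integral_translation (a : R) (f : mR -> \bar R) :
  measurable_fun setT f -> (forall x, 0 <= f x)%E ->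
  (\int[mu]_x f (x + a)%R = \int[mu]_x f x)%E.
Proof.
move=> mf f0.
have := ge0_integral_pushforward (measurable_addr a) mu measurableT mf (fun x _ => f0 x).
rewrite preimage_setT => /= <-.
apply/esym; apply: eq_measure_integral => [|mT A mA _].
  exact: measurable_addr.
exact: lebesgue_measure_translation.
Qed.

Local Notation mR2 := (mR * mR)%type.
Local Notation mu2 := (lebesgue2 R).

Lemma measurable_shear_fst (a : R) :
  measurable_fun setT (fun z : mR2 => (z.1 + a * z.2, z.2)%R : mR2).
Proof.
apply: measurable_fun_pair => //=.
by apply: measurable_funD => //; exact: measurable_funM.
Qed.

Lemma measurable_shear_snd (a : R) :
  measurable_fun setT (fun z : mR2 => (z.1, z.2 + a * z.1)%R : mR2).
Proof.
apply: measurable_fun_pair => //=.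
by apply: measurable_funD => //; exact: measurable_funM.
Qed.

(** On each horizontal line the shear is a translation. *)
Lemma integral_shear_fst (a : R) (f : mR2 -> \bar R) :
  measurable_fun setT f -> (forall x, 0 <= f x)%E ->
  (\int[mu2]_z f (z.1 + a * z.2, z.2)%R = \int[mu2]_z f z)%E.
Proof.
move=> mf f0.
have mg := measurable_shear_fst a.
rewrite fubini_tonelli2//=; last exact: measurableT_comp.
rewrite [RHS]fubini_tonelli2//=.
apply: eq_integral => y _; rewrite /fubini_G /=.
rewrite (@integral_translation _ (fun x => f (x, y)))//.
exact: (measurable_fun_pair1 _ mf).
Qed.

Lemma integral_shear_snd (a : R) (f : mR2 -> \bar R) :
  measurable_fun setT f -> (forall x, 0 <= f x)%E ->
  (\int[mu2]_z f (z.1, z.2 + a * z.1)%R = \int[mu2]_z f z)%E.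
Proof.
move=> mf f0.
have mg := measurable_shear_snd a.
rewrite fubini_tonelli1//=; last exact: measurableT_comp.
rewrite [RHS]fubini_tonelli1//=.
apply: eq_integral => x _; rewrite /fubini_F /=.
rewrite (@integral_translation _ (fun y => f (x, y)))//.
exact: (measurable_fun_pair2 _ mf).
Qed.

Definition rotation (c s : R) (z : mR2) : mR2 :=
  (c * z.1 - s * z.2, s * z.1 + c * z.2).

Lemma measurable_rotation c s : measurable_fun setT (rotation c s).
Proof.
apply: measurable_fun_pair => /=.
  by apply: measurable_funB; exact: measurable_funM.
by apply: measurable_funD; exact: measurable_funM.
Qed.

(** A rotation by an angle other than pi is a product of three shears: with
    a = - s / (1 + c) = - tan (theta / 2), shear horizontally by a, vertically
    by s, and horizontally by a again. The half-turn is the square of a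
    quarter-turn. *)
Lemma integral_rotation (c s : R) (f : mR2 -> \bar R) :
  c ^+ 2 + s ^+ 2 = 1 -> measurable_fun setT f -> (forall x, 0 <= f x)%E ->
  (\int[mu2]_z f (rotation c s z) = \int[mu2]_z f z)%E.
Proof.
have three_shears c' s' g : 1 + c' != 0 -> c' ^+ 2 + s' ^+ 2 = 1 ->
    measurable_fun setT g -> (forall x, 0 <= g x)%E ->
    (\int[mu2]_z g (rotation c' s' z) = \int[mu2]_z g z)%E.
  move=> c1 cs mg g0; pose a := - s' / (1 + c').
  have mg1 := measurableT_comp mg (measurable_shear_fst a).
  have mg2 := measurableT_comp mg1 (measurable_shear_snd s').
  rewrite -[RHS](integral_shear_fst a mg g0).
  rewrite -[RHS](integral_shear_snd s' mg1 (fun=> g0 _)).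
  rewrite -[RHS](integral_shear_fst a mg2 (fun=> g0 _)).
  apply: eq_integral => -[x y] _; congr g; rewrite /rotation /=.
  have s2 : s' ^+ 2 = (1 - c') * (1 + c').
    by move: cs => /(canRL (addKr _)) ->; ring.
  have as1 : a * s' = c' - 1.
    by rewrite /a mulrAC mulNr -expr2 s2; field.
  have aE : a * c' = - s' - a by rewrite /a; field.
  congr pair; last by ring: as1.
  have -> : x + a * y + a * (y + s' * (x + a * y)) =
    (x + a * y) * (1 + a * s') + a * y by ring.
  rewrite as1.
  by ring: aE.
move=> cs mf f0; have [c1|c1] := eqVneq (1 + c) 0; last exact: three_shears.
have cE : c = -1 by apply/eqP; rewrite -addr_eq0 addrC c1.
have s0 : s = 0.
  move: cs; rewrite cE sqrrN expr1n => /(canRL (addKr _)).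
  by rewrite addNr => /eqP; rewrite sqrf_eq0 => /eqP.
have q : (0 : R) ^+ 2 + 1 ^+ 2 = 1 by rewrite expr0n/= expr1n add0r.
have q0 : 1 + (0 : R) != 0 by rewrite addr0 oner_eq0.
have mf1 := measurableT_comp mf (measurable_rotation 0 1).
rewrite -[RHS](three_shears 0 1 f) //.
rewrite -[RHS](three_shears 0 1 (fun z => f (rotation 0 1 z))) //.
by apply: eq_integral => -[x y] _; congr f; rewrite /rotation/= s0 cE; congr pair; ring.
Qed.

Local Notation mu4 := (lebesgue4 R).

Lemma integral_rotation2 (c s c' s' : R) (f : mR2 * mR2 -> \bar R) :
  c ^+ 2 + s ^+ 2 = 1 -> c' ^+ 2 + s' ^+ 2 = 1 ->
  measurable_fun setT f -> (forall x, 0 <= f x)%E ->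
  (\int[mu4]_z f (rotation c s z.1, rotation c' s' z.2) = \int[mu4]_z f z)%E.
Proof.
move=> cs cs' mf f0.
have m1 : measurable_fun setT (fun z : mR2 * mR2 => f (rotation c s z.1, rotation c' s' z.2)).
  apply: measurableT_comp => //; apply: measurable_fun_pair => /=.
    exact: (measurableT_comp (measurable_rotation c s)).
  exact: (measurableT_comp (measurable_rotation c' s')).
have m2 : measurable_fun setT (fun z : mR2 * mR2 => f (rotation c s z.1, z.2)).
  apply: measurableT_comp => //; apply: measurable_fun_pair => //=.
  exact: (measurableT_comp (measurable_rotation c s)).
transitivity (\int[mu4]_z f (rotation c s z.1, z.2))%E.
  rewrite fubini_tonelli1//= [RHS]fubini_tonelli1//=.
  apply: eq_integral => x _; rewrite /fubini_F /=.
  rewrite (@integral_rotation _ _ (fun y => f (rotation c s x, y)))//.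
  exact: (measurable_fun_pair2 _ mf).
rewrite fubini_tonelli2//= [RHS]fubini_tonelli2//=.
apply: eq_integral => y _; rewrite /fubini_G /=.
rewrite (@integral_rotation _ _ (fun x => f (x, y)))//.
exact: (measurable_fun_pair1 _ mf).
Qed.

End rotation_invariance.

(** * Measurability of continuous functions on R^4 *)

Section countable_base.

(** Open sets for a product topology are not measurable for the product
    sigma-algebra in general; they are when every neighbourhood can be refined
    inside one countable family of measurable sets, and this property passes to
    products. Neighbourhoods are a parameter [nb] because the topology and the
    sigma-algebra live in separate structures on the same carrier. *)
Definition measurable_base d (T : measurableType d) (nb : T -> set (set T)) : Prop :=
  exists (I : countType) (B : I -> set T),
    (forall i, measurable (B i)) /\
    forall x N, nb x N -> exists2 i, B i x & B i `<=` N.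

Lemma measurable_base_open d (T : measurableType d) (nb : T -> set (set T)) U :
  measurable_base nb -> (forall x, U x -> nb x U) -> measurable U.
Proof.
move=> [I [B [mB H]]] opU.
have -> : U = \bigcup_(i in [set i | B i `<=` U]) B i.
  apply/seteqP; split => [x /opU/H[i Bx BU]|x [i /= BU /BU//]].
  by exists i.
rewrite bigcup_mkcond; apply: countable_bigcupT_measurable => // i.
by case: ifPn.
Qed.

Lemma measurable_base_prod d1 d2 (T1 : measurableType d1) (T2 : measurableType d2)
    (nb1 : T1 -> set (set T1)) (nb2 : T2 -> set (set T2)) :
  measurable_base nb1 -> measurable_base nb2 ->
  measurable_base (fun x : T1 * T2 =>
    [set N | exists2 M, nb1 x.1 M.1 /\ nb2 x.2 M.2 & M.1 `*` M.2 `<=` N]).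
Proof.
move=> [I [B [mB HB]]] [J [C [mC HC]]].
exists (I * J)%type, (fun ij => B ij.1 `*` C ij.2); split.
  by move=> ij; exact: measurableX.
move=> x N [[M1 M2] /= [/HB[i Bi iM] /HC[j Cj jM]] MN].
by exists (i, j) => // y [/= /iM ? /jM ?]; exact: MN.
Qed.

Lemma measurable_base_R (R : realType) :
  measurable_base (nbhs : measurableTypeR R -> set (set (measurableTypeR R))).
Proof.
exists (rat * rat)%type, (fun pq => `]ratr pq.1, ratr pq.2[%classic); split.
  by move=> pq; exact: measurable_itv.
move=> x N /nbhs_ballP[e /= e0 eN].
have [p] := @rat_in_itvoo R (x - e) x (ltac:(by rewrite ltrBlDr ltrDl)).
have [q] := @rat_in_itvoo R x (x + e) (ltac:(by rewrite ltrDl)).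
rewrite !in_itv/= => /andP[xq qe] /andP[ep px].
exists (p, q); first by rewrite /= in_itv/= px.
move=> y /=; rewrite in_itv/= => /andP[py yq]; apply: eN.
by rewrite /ball /= ltr_distlC; apply/andP; split; lra.
Qed.

(** The open boxes with rational vertices form the countable family. *)
Lemma open_measurable_R4 (R : realType) (U : set (R4 R)) : open U ->
  measurable (U : set ((measurableTypeR R * measurableTypeR R) *
                       (measurableTypeR R * measurableTypeR R))).
Proof.
move=> oU.
have b1 := measurable_base_R R; have b2 := measurable_base_prod b1 b1.
apply: (measurable_base_open (measurable_base_prod b2 b2)) => x Ux.
have : nbhs x U by exact: open_nbhs_nbhs.
move=> [[A B] /= [[A' HA AA] [B' HB BB]] AB]; exists (A, B) => //=.
by split; [exists A'|exists B'].
Qed.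

Lemma continuous_measurable_R4 (R : realType) (U : set (R4 R)) (f : R4 R -> R) :
  open U -> (forall x, U x -> {for x, continuous f}) ->
  measurable_fun (U : set ((measurableTypeR R * measurableTypeR R) *
                       (measurableTypeR R * measurableTypeR R))) f.
Proof.
move=> oU cf; apply: (measurability _ (RGenOInfty.measurableE R)) => //.
move=> /= _ [_ [a ->] <-].
apply: open_measurable_R4; rewrite openE => x [Ux fx].
apply: filterI; first exact: open_nbhs_nbhs.
apply: cf => //.
apply: open_nbhs_nbhs; split => //; exact: interval_open.
Qed.

End countable_base.

(** * Goursat's theorem on rectangles *)

Section segment_integral.
Variable R : realType.
Local Notation mu := (@lebesgue_measure R).

Lemma segment_integrable (f : R -> R) (a b : R) :
  (forall x, a <= x <= b -> {for x, continuous f}) ->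
  mu.-integrable `[a, b] (EFin \o f).
Proof.
move=> cf; apply: continuous_compact_integrable; first exact: segment_compact.
apply: continuous_in_subspaceT => x; rewrite inE/= in_itv/= => xab.
exact: cf.
Qed.

Lemma segment_integral_cat (f : R -> R) (a m b : R) : a <= m <= b ->
  (forall x, a <= x <= b -> {for x, continuous f}) ->
  \int[mu]_(x in `[a, b]) f x =
  \int[mu]_(x in `[a, m]) f x + \int[mu]_(x in `[m, b]) f x.
Proof.
move=> /andP[am mb] cf.
have iab := segment_integrable cf.
have imb : mu.-integrable `[m, b] (EFin \o f).
  by apply: segment_integrable => x /andP[mx xb]; apply: cf; rewrite xb (le_trans am).
have := Rintegral_itvB (x := m) iab; rewrite !bnd_simp => /(_ am mb)/(canRL (subrK _)) ->.
rewrite addrC; congr (_ + _); apply: Rintegral_itv_obnd_cbnd.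
by apply: integrableS imb => //; exact: subset_itv_oc_cc.
Qed.

Lemma segment_integral_near_cst (f : R -> R) (a b k e : R) : a <= b ->
  (forall x, a <= x <= b -> {for x, continuous f}) ->
  (forall x, a <= x <= b -> `|f x - k| <= e) ->
  `|\int[mu]_(x in `[a, b]) f x - k * (b - a)| <= e * (b - a).
Proof.
move=> ab cf fk.
have iab := segment_integrable cf.
have ic r : mu.-integrable `[a, b] (EFin \o cst r).
  by apply: segment_integrable => x _; exact: cvg_cst.
have Ic r : \int[mu]_(x in `[a, b]) r = r * (b - a).
  rewrite Rintegral_cst//= lebesgue_measure_itv/= lte_fin.
  by move: ab; rewrite le_eqVlt => /predU1P[->|->//]; rewrite ltxx subrr.
have iB : mu.-integrable `[a, b] (EFin \o (fun x => f x - k)).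
  by apply: segment_integrable => x xab; apply: cvgB; [exact: cf|exact: cvg_cst].
rewrite -(Ic k) -(Ic e) -RintegralB //; last exact: ic.
apply: le_trans (le_normr_Rintegral _ iB) _ => //.
by apply: le_Rintegral => //; [exact: integrable_norm iB|exact: ic].
Qed.

End segment_integral.

Section goursat.
Variable R : realType.
Local Notation mu := (@lebesgue_measure R).
Variables P Q : R -> R -> R.

(** The form Q ds + P dt is closed at (s, t): P and Q are differentiable there
    and their partial derivatives P_s and Q_t agree (both are [a]). For P = Re h
    and Q = Im h, so that the form is Im (h (ds + i dt)), this is implied by
    complex differentiability of h. *)
Definition closed_at (s t : R) := exists a b c : R,
  forall e, 0 < e -> exists2 d, 0 < d & forall s' t',
    `|s' - s| < d -> `|t' - t| < d ->
    `|P s' t' - P s t - (a * (s' - s) + b * (t' - t))|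
       <= e * (`|s' - s| + `|t' - t|) /\
    `|Q s' t' - Q s t - (c * (s' - s) + a * (t' - t))|
       <= e * (`|s' - s| + `|t' - t|).

(** The integral of Q ds + P dt along the counterclockwise boundary of
    [s0, s1] x [t0, t1]. *)
Definition circulation (s0 s1 t0 t1 : R) : R :=
  (\int[mu]_(t in `[t0, t1]) P s1 t - \int[mu]_(t in `[t0, t1]) P s0 t) -
  (\int[mu]_(s in `[s0, s1]) Q s t1 - \int[mu]_(s in `[s0, s1]) Q s t0).

Lemma first_order_continuous (f : R -> R) (x k : R) :
  (forall e, 0 < e -> exists2 d, 0 < d & forall y, `|y - x| < d ->
     `|f y - f x - k * (y - x)| <= e * `|y - x|) ->
  {for x, continuous f}.
Proof.
move=> /(_ 1 ltr01)[d d0 fd]; apply/cvgrPdist_lt => /= e e0.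
have k0 : 0 < 1 + `|k| by rewrite ltr_pwDl.
near=> y; have yd : `|y - x| < d.
  by rewrite distrC; near: y; apply: cvgr_dist_lt.
have ye : `|y - x| < e / (1 + `|k|).
  rewrite distrC; near: y; apply: cvgr_dist_lt => //; exact: divr_gt0.
rewrite distrC -(subrK (k * (y - x)) (f y - f x)).
apply: le_lt_trans (ler_normD _ _) _.
rewrite normrM; apply: le_lt_trans (lerD (fd _ yd) (lexx _)) _.
by rewrite -mulrDl mulrC -ltr_pdivlMr.
Unshelve. all: by end_near. Qed.

Lemma closed_at_continuousP s t : closed_at s t ->
  {for t, continuous (P s)} /\ {for s, continuous (P ^~ t)}.
Proof.
move=> [a [b [c H]]]; split.
  apply: (@first_order_continuous _ _ b) => e /H[d d0 Hd]; exists d => // y yt.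
  have := (Hd s y); rewrite subrr normr0 => /(_ d0 yt)[+ _].
  by rewrite mulr0 !add0r.
apply: (@first_order_continuous _ _ a) => e /H[d d0 Hd]; exists d => // y ys.
have := (Hd y t); rewrite subrr normr0 => /(_ ys d0)[+ _].
by rewrite mulr0 !addr0.
Qed.

Lemma closed_at_continuousQ s t : closed_at s t ->
  {for t, continuous (Q s)} /\ {for s, continuous (Q ^~ t)}.
Proof.
move=> [a [b [c H]]]; split.
  apply: (@first_order_continuous _ _ a) => e /H[d d0 Hd]; exists d => // y yt.
  have := (Hd s y); rewrite subrr normr0 => /(_ d0 yt)[_ +].
  by rewrite mulr0 !add0r.
apply: (@first_order_continuous _ _ c) => e /H[d d0 Hd]; exists d => // y ys.
have := (Hd y t); rewrite subrr normr0 => /(_ ys d0)[_ +].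
by rewrite mulr0 !addr0.
Qed.

Definition closed_on (s0 s1 t0 t1 : R) :=
  forall s t, s0 <= s <= s1 -> t0 <= t <= t1 -> closed_at s t.

Lemma circulation_split_fst s0 m s1 t0 t1 : closed_on s0 s1 t0 t1 ->
  s0 <= m <= s1 -> t0 <= t1 ->
  circulation s0 s1 t0 t1 = circulation s0 m t0 t1 + circulation m s1 t0 t1.
Proof.
move=> C msub t01; rewrite /circulation.
rewrite (segment_integral_cat (f := Q ^~ t1) msub); last first.
  by move=> x xs; apply: (closed_at_continuousQ (C _ _ xs _)).2; rewrite t01 lexx.
rewrite (segment_integral_cat (f := Q ^~ t0) msub); last first.
  by move=> x xs; apply: (closed_at_continuousQ (C _ _ xs _)).2; rewrite t01 lexx.
ring.
Qed.

Lemma circulation_split_snd s0 s1 t0 m t1 : closed_on s0 s1 t0 t1 ->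
  s0 <= s1 -> t0 <= m <= t1 ->
  circulation s0 s1 t0 t1 = circulation s0 s1 t0 m + circulation s0 s1 m t1.
Proof.
move=> C s01 msub; rewrite /circulation.
rewrite (segment_integral_cat (f := P s1) msub); last first.
  by move=> x xt; apply: (closed_at_continuousP (C _ _ _ xt)).1; rewrite s01 lexx.
rewrite (segment_integral_cat (f := P s0) msub); last first.
  by move=> x xt; apply: (closed_at_continuousP (C _ _ _ xt)).1; rewrite s01 lexx.
ring.
Qed.

(** The affine part of (P, Q) contributes P_s l m - Q_t l m = 0, so only the
    first-order remainder is left. The difference of its values at facing points
    of opposite sides is at most 2 e (l + m), and the sides have lengths l and
    m. *)
Lemma circulation_small (s t e : R) : closed_at s t -> 0 < e ->
  exists2 d, 0 < d & forall a b l m, 0 <= l -> 0 <= m -> l + m < d ->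
    a <= s <= a + l -> b <= t <= b + m -> closed_on a (a + l) b (b + m) ->
    `|circulation a (a + l) b (b + m)| <= 2 * e * (l + m) ^+ 2.
Proof.
move=> [al [be [ga H]]] e0; have [d d0 Hd] := H _ e0.
exists d => // a b l m l0 m0 lmd /andP[as_ sl] /andP[bt tm] C.
have al_ : a <= a + l by rewrite lerDl.
have bm_ : b <= b + m by rewrite lerDl.
have aa : a <= a <= a + l by rewrite lexx.
have ll : a <= a + l <= a + l by rewrite lexx andbT.
have bb : b <= b <= b + m by rewrite lexx.
have mm : b <= b + m <= b + m by rewrite lexx andbT.
have near_s s' : a <= s' <= a + l -> `|s' - s| <= l.
  by move=> /andP[? ?]; rewrite ler_norml; apply/andP; split; lra.
have near_t t' : b <= t' <= b + m -> `|t' - t| <= m.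
  by move=> /andP[? ?]; rewrite ler_norml; apply/andP; split; lra.
have est s' t' : a <= s' <= a + l -> b <= t' <= b + m ->
    `|P s' t' - P s t - (al * (s' - s) + be * (t' - t))| <= e * (l + m) /\
    `|Q s' t' - Q s t - (ga * (s' - s) + al * (t' - t))| <= e * (l + m).
  move=> /near_s hs /near_t ht.
  have [|| h1 h2] := Hd s' t'; [lra|lra|].
  have h : e * (`|s' - s| + `|t' - t|) <= e * (l + m).
    by rewrite ler_pM2l// lerD.
  by split; [exact: le_trans h1 h|exact: le_trans h2 h].
have estP t' : b <= t' <= b + m -> `|P (a + l) t' - P a t' - al * l| <= 2 * e * (l + m).
  move=> ht; have [h1 _] := est _ _ ll ht; have [h2 _] := est _ _ aa ht.
  have -> : P (a + l) t' - P a t' - al * l =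
    (P (a + l) t' - P s t - (al * (a + l - s) + be * (t' - t))) -
    (P a t' - P s t - (al * (a - s) + be * (t' - t))) by ring.
  by apply: le_trans (ler_normB _ _) _; apply: le_trans (lerD h1 h2) _; lra.
have estQ s' : a <= s' <= a + l -> `|Q s' (b + m) - Q s' b - al * m| <= 2 * e * (l + m).
  move=> hs; have [_ h1] := est _ _ hs mm; have [_ h2] := est _ _ hs bb.
  have -> : Q s' (b + m) - Q s' b - al * m =
    (Q s' (b + m) - Q s t - (ga * (s' - s) + al * (b + m - t))) -
    (Q s' b - Q s t - (ga * (s' - s) + al * (b - t))) by ring.
  by apply: le_trans (ler_normB _ _) _; apply: le_trans (lerD h1 h2) _; lra.
have cP s' : a <= s' <= a + l -> forall x, b <= x <= b + m -> {for x, continuous (P s')}.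
  by move=> hs x hx; apply: (closed_at_continuousP (C _ _ hs hx)).1.
have cQ t' : b <= t' <= b + m -> forall x, a <= x <= a + l -> {for x, continuous (Q ^~ t')}.
  by move=> ht x hx; apply: (closed_at_continuousQ (C _ _ hx ht)).2.
rewrite /circulation.
rewrite -RintegralB//; [|exact: segment_integrable (cP _ ll)|exact: segment_integrable (cP _ aa)].
rewrite -RintegralB//; [|exact: segment_integrable (cQ _ mm)|exact: segment_integrable (cQ _ bb)].
have IP := segment_integral_near_cst (f := fun x => P (a + l) x - P a x) bm_
  (fun x hx => cvgB (cP _ ll x hx) (cP _ aa x hx)) estP.
have IQ := segment_integral_near_cst (f := fun x => Q x (b + m) - Q x b) al_
  (fun x hx => cvgB (cQ _ mm x hx) (cQ _ bb x hx)) estQ.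
move: IP IQ; rewrite !(addrAC _ _ (- _)) !subrr !add0r.
set X := \int[mu]_(t in _) _; set Y := \int[mu]_(t in _) _ => IP IQ.
have -> : X - Y = (X - al * l * m) - (Y - al * m * l) by ring.
have F (x : R) : Filter (nbhs x) by exact: nbhs_filter.
apply: le_trans (ler_normB _ _) _; apply: le_trans (lerD (IP F) (IQ F)) _.
by rewrite -mulrDr expr2 mulrA [m + l]addrC.
Qed.

(** The circulations of the four quarters add up to that of the rectangle, so
    one of them is at least a quarter of it in absolute value. *)
Lemma quarter_circulation (a b l m e : R) : 0 <= l -> 0 <= m ->
  closed_on a (a + l) b (b + m) ->
  e < `|circulation a (a + l) b (b + m)| ->
  exists a' b', [/\ a <= a', a' + l / 2 <= a + l, b <= b', b' + m / 2 <= b + m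
    & e / 4 < `|circulation a' (a' + l / 2) b' (b' + m / 2)| ].
Proof.
move=> l0 m0 C.
have mid (x k : R) : 0 <= k -> x <= x + k / 2 <= x + k by move=> k0; apply/andP; split; lra.
have half (x k : R) : x + k = x + k / 2 + k / 2 by lra.
rewrite (circulation_split_fst C (mid _ _ l0)); last by lra.
rewrite (circulation_split_snd _ _ (mid _ _ m0)); [|by move=> s t hs ht; apply: C => //; lra|lra].
rewrite (circulation_split_snd _ _ (mid _ _ m0)); [|by move=> s t hs ht; apply: C => //; lra|lra].
rewrite (half a l) (half b m); set X1 := circulation _ _ _ _; set X2 := circulation _ _ _ _.
set X3 := circulation _ _ _ _; set X4 := circulation _ _ _ _ => big.
have [h1|h1] := ltP (e / 4) `|X1|; first by exists a, b; split=> //; lra.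
have [h2|h2] := ltP (e / 4) `|X2|; first by exists a, (b + m / 2); split=> //; lra.
have [h3|h3] := ltP (e / 4) `|X3|; first by exists (a + l / 2), b; split=> //; lra.
have [h4|h4] := ltP (e / 4) `|X4|; first by exists (a + l / 2), (b + m / 2); split=> //; lra.
have := ler_normD (X1 + X2) (X3 + X4); have := ler_normD X1 X2; have := ler_normD X3 X4.
lra.
Qed.

Lemma nested_segments (a : nat -> R) (l : R) :
  (forall n, a n <= a n.+1 /\ a n.+1 + l / 2 ^+ n.+1 <= a n + l / 2 ^+ n) -> 0 <= l ->
  exists x, forall n, a n <= x <= a n + l / 2 ^+ n.
Proof.
move=> an l0.
have nd : {homo a : n m / (n <= m)%N >-> n <= m}.
  by apply: homo_leq => // [x y z|n]; [exact: le_trans|exact: (an n).1].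
have ni : {homo (fun n => a n + l / 2 ^+ n) : n m / (n <= m)%N >-> m <= n}.
  apply: (homo_leq (r := fun x y => y <= x)) => // [x y z h1 h2|n].
    exact: le_trans h2 h1.
  exact: (an n).2.
have ub n m : a m <= a n + l / 2 ^+ n.
  have h k : a k <= a k + l / 2 ^+ k by rewrite lerDl divr_ge0// exprn_ge0.
  have [mn|/ltnW nm] := leqP m n; first exact: le_trans (nd _ _ mn) (h n).
  exact: le_trans (h m) (ni _ _ nm).
have sa : has_sup (range a).
  by split; [exists (a 0%N), 0%N|exists (a 0%N + l / 2 ^+ 0) => _ [n _ <-]].
exists (sup (range a)) => n; apply/andP; split.
  by apply: ub_le_sup; [exact: sa.2|exists n].
by apply: ge_sup; [exact: sa.1|move=> _ [k _ <-]].
Qed.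

(** If the circulation were nonzero, repeated quartering would produce nested
    rectangles of sides l / 2^n and m / 2^n whose circulation exceeds E / 4^n,
    whereas at their common point [circulation_small] makes it o(4^-n). *)
Lemma goursat (s0 s1 t0 t1 : R) : s0 <= s1 -> t0 <= t1 ->
  closed_on s0 s1 t0 t1 -> circulation s0 s1 t0 t1 = 0.
Proof.
move=> s01 t01 C; apply/eqP; rewrite -normr_eq0; apply/negPn/negP => fN0.
pose E := `|circulation s0 s1 t0 t1| / 2; pose l := s1 - s0; pose m := t1 - t0.
have E0 : 0 < E by rewrite divr_gt0// lt_def fN0 normr_ge0.
have l0 : 0 <= l by rewrite subr_ge0.
have m0 : 0 <= m by rewrite subr_ge0.
pose good n (p : R * R) :=
  [/\ s0 <= p.1, p.1 + l / 2 ^+ n <= s1, t0 <= p.2, p.2 + m / 2 ^+ n <= t1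
    & E / 4 ^+ n < `|circulation p.1 (p.1 + l / 2 ^+ n) p.2 (p.2 + m / 2 ^+ n)|].
pose nested n (p q : R * R) :=
  (p.1 <= q.1 /\ q.1 + l / 2 ^+ n.+1 <= p.1 + l / 2 ^+ n) /\
  (p.2 <= q.2 /\ q.2 + m / 2 ^+ n.+1 <= p.2 + m / 2 ^+ n).
have halves (k : R) n : k / 2 ^+ n.+1 = k / 2 ^+ n / 2 by rewrite exprSr invfM mulrA.
have fourth n : E / 4 ^+ n.+1 = E / 4 ^+ n / 4 by rewrite exprSr invfM mulrA.
have scale_ge0 (k : R) n : 0 <= k -> 0 <= k / 2 ^+ n by move=> ?; rewrite divr_ge0// exprn_ge0.
have step n p : good n p -> exists q, good n.+1 q /\ nested n p q.
  move=> [h1 h2 h3 h4 h5].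
  have [||//|a' [b' [g1 g2 g3 g4 g5]]] := quarter_circulation _ _ _ h5; [exact: scale_ge0..| |].
    move=> s t /andP[? ?] /andP[? ?]; apply: C; apply/andP; split; lra.
  by exists (a', b'); rewrite /good /nested /= !halves fourth; do !split => //; lra.
pose next n p := xget p [set q | good n.+1 q /\ nested n p q].
have nextP n p : good n p -> good n.+1 (next n p) /\ nested n p (next n p).
  by move=> /step; exact: (@xgetPex _ p [set q | good n.+1 q /\ nested n p q]).
pose u := fix u n := if n is n'.+1 then next n' (u n') else (s0, t0).
have gu n : good n (u n).
  elim: n => [|n /nextP[]//].
  rewrite /good /= !expr0 !divr1 !(addrC _ (_ - _)) !subrK; split => //.
  by rewrite ltr_pdivrMr// ltr_pMr ?ltr1n// lt_def fN0 normr_ge0.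
have nu n : nested n (u n) (u n.+1).
  by have [] := nextP _ _ (gu n).
have [s Hs] := nested_segments (a := fun n => (u n).1) (fun n => (nu n).1) l0.
have [t Ht] := nested_segments (a := fun n => (u n).2) (fun n => (nu n).2) m0.
have Cst : closed_at s t.
  have [h1 h2 h3 h4 _] := gu 0%N; move: (Hs 0%N) (Ht 0%N) => /andP[? ?] /andP[? ?].
  by apply: C; apply/andP; split; lra.
(* With this e, the bound 2 e (l + m)^2 / 4^n is less than E / 4^n; the summand
   1 avoids a zero denominator. *)
pose e := E / (2 * (1 + (l + m) ^+ 2)).
have q0 : 0 < 1 + (l + m) ^+ 2 by rewrite ltr_pwDl// sqr_ge0.
have e0 : 0 < e by rewrite divr_gt0// mulr_gt0.
have [d d0 Hd] := circulation_small Cst e0.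
have [n nd] : exists n, (l + m) / 2 ^+ n < d.
  have half1 : `|2^-1| < 1 :> R by rewrite ger0_norm ?invf_lt1 ?ltr1n.
  have := cvg_geometric (l + m) half1 => /cvgrPdist_lt /(_ _ d0)[N _ /(_ N (leqnn N))].
  rewrite /= sub0r normrN exprVn => h; exists N.
  by apply: le_lt_trans h; exact: ler_norm.
have [h1 h2 h3 h4 h5] := gu n.
move: h5; apply/negP; rewrite -leNgt.
apply: le_trans (Hd _ _ _ _ (scale_ge0 _ _ l0) (scale_ge0 _ _ m0) _ (Hs n) (Ht n) _) _.
- by rewrite -mulrDl.
- move=> s' t' /andP[? ?] /andP[? ?]; apply: C; apply/andP; split; lra.
have -> : 2 * e * (l / 2 ^+ n + m / 2 ^+ n) ^+ 2 = 2 * e * (l + m) ^+ 2 / 4 ^+ n.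
  have -> : 4 = 2 ^+ 2 :> R by rewrite -natrX.
  by rewrite -mulrDl expr_div_n mulrA -!exprM mulnC.
rewrite ler_pM2r ?invr_gt0 ?exprn_gt0// /e.
have -> : 2 * (E / (2 * (1 + (l + m) ^+ 2))) * (l + m) ^+ 2 =
  E * ((l + m) ^+ 2 / (1 + (l + m) ^+ 2)) by field; rewrite gt_eqF.
by rewrite ler_piMr ?(ltW E0)// ler_pdivrMr// mul1r lerDr.
Qed.

End goursat.

(** * The complex exponential and circle means *)

Section first_order.
Variable K : numFieldType.

(** The difference quotient is undefined at zero increment; the multiplied-out
    form is easier to combine with explicit estimates, and it applies to real and
    complex differentiation alike. *)
Lemma derivative_first_orderP (f : K^o -> K^o) (x k : K^o) :
  is_derive x 1 f k <->
  (forall e : K, 0 < e -> exists2 d : K, 0 < d & forall h : K,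
     `|h| < d -> `|f (x + h) - f x - k * h| <= e * `|h|).
Proof.
split.
  move=> [df dE] e e0.
  have : h^-1 *: ((f \o shift x) (h *: (1 : K^o)) - f x) @[h --> (0 : K)^'] --> k.
    by rewrite -dE; exact: df.
  move=> /cvgrPdist_le /(_ _ e0) /nbhs_normP[d /= d0 H].
  exists d => // h hd.
  have [->|h0] := eqVneq h 0.
    by rewrite addr0 subrr mulr0 subr0 normr0 mulr0.
  have := H h; rewrite /= sub0r normrN => /(_ hd h0).
  rewrite /= [h *: 1]mulr1 [h + x]addrC => H'.
  have -> : f (x + h) - f x - k * h = - (h * (k - h^-1 * (f (x + h) - f x))).
    by field.
  by rewrite normrN normrM mulrC ler_wpM2r.
move=> H.
have lim : h^-1 *: ((f \o shift x) (h *: (1 : K^o)) - f x) @[h --> (0 : K)^'] --> k.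
  apply/cvgrPdist_le => e e0; have [d d0 Hd] := H e e0.
  apply/nbhs_normP; exists d => //= h; rewrite /= sub0r normrN => hd h0.
  rewrite /= [h *: 1]mulr1 [h + x]addrC.
  have -> : k - h^-1 *: (f (x + h) - f x) = - (h^-1 * (f (x + h) - f x - k * h)).
    by rewrite /GRing.scale/=; field.
  rewrite normrN normrM normfV mulrC ler_pdivrMr ?normr_gt0//.
  exact: Hd.
by apply: DeriveDef; [apply/cvg_ex; exists k|exact: cvg_lim lim].
Qed.

End first_order.

Section complex_exponential.
Variable R : realType.
Local Open Scope complex_scope.
Local Notation normc := Normc.normc.
Local Notation Re := complex.Re.
Local Notation Im := complex.Im.

Lemma normr_normc (z : R[i]) : `|z| = (normc z)%:C.
Proof. by case: z => a b; rewrite normc_def. Qed.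

Lemma normc_ge0 (z : R[i]) : 0 <= normc z.
Proof. by case: z => a b; exact: sqrtr_ge0. Qed.

Lemma normc_ge_Re (z : R[i]) : `|Re z| <= normc z.
Proof.
case: z => a b /=; rewrite -sqrtr_sqr ler_wsqrtr//.
by rewrite lerDl sqr_ge0.
Qed.

Lemma normc_ge_Im (z : R[i]) : `|Im z| <= normc z.
Proof.
case: z => a b /=; rewrite -sqrtr_sqr ler_wsqrtr//.
by rewrite lerDr sqr_ge0.
Qed.

Lemma normc_le_ReIm (z : R[i]) : normc z <= `|Re z| + `|Im z|.
Proof.
case: z => a b /=.
rewrite -[leRHS]ger0_norm ?addr_ge0// -sqrtr_sqr ler_wsqrtr//.
rewrite -(real_normK (num_real a)) -(real_normK (num_real b)) sqrrD addrAC lerDl.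
by rewrite mulrn_wge0// mulr_ge0.
Qed.

Lemma gt0_complexE (e : R[i]) : 0 < e -> 0 < Re e /\ e = (Re e)%:C.
Proof. by case: e => a b; rewrite ltcE/= => /andP[/eqP -> ?]. Qed.

Definition cexp (z : R[i]) : R[i] :=
  expR (Re z) * cos (Im z) +i* (expR (Re z) * sin (Im z)).

Lemma cexpD (z w : R[i]) : cexp (z + w) = cexp z * cexp w.
Proof.
case: z w => [a b] [c d]; rewrite /cexp /= expRD cosD sinD.
by apply/eqP; rewrite eq_complex /=; apply/andP; split; apply/eqP; ring.
Qed.

(** By the first-order expansions of exp, cos and sin at 0, using
      e^s cos t - 1 - s = e^s (cos t - 1) + (e^s - 1 - s),
      e^s sin t - t     = e^s (sin t - t) + (e^s - 1) t. *)
Lemma cexp_first_order (e : R) : 0 < e -> exists2 d : R, 0 < d &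
  forall s t, `|s| < d -> `|t| < d ->
    normc (cexp (s +i* t) - 1 - (s +i* t)) <= e * (`|s| + `|t|).
Proof.
move=> e0; pose e' := Num.min 1 (e / 6).
have e'0 : 0 < e' by rewrite lt_min ltr01 divr_gt0.
have [e'1 e'e] : e' <= 1 /\ e' <= e / 6 by split; rewrite ge_min lexx ?orbT.
have /derivative_first_orderP/(_ _ e'0)[d1 d10 H1] := is_derive_expR (0 : R).
have /derivative_first_orderP/(_ _ e'0)[d2 d20 H2] := is_derive_cos (0 : R).
have /derivative_first_orderP/(_ _ e'0)[d3 d30 H3] := is_derive_sin (0 : R).
have e40 : 0 < e' / 2 by rewrite divr_gt0.
exists (Num.min (Num.min d1 (e' / 2)) (Num.min d2 d3)).
  by rewrite !lt_min d10 e40 d20.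
move=> s t; rewrite !lt_min => /andP[/andP[s1 s2] _] /andP[_ /andP[t2 t3]].
have := H1 _ s1; rewrite add0r expR0 mul1r => E1'.
have E1 : `|expR s - 1 - s| <= e' * `|s| := E1'.
have := H2 _ t2; rewrite add0r cos0 sin0 oppr0 mul0r subr0 => E2.
have := H3 _ t3; rewrite add0r cos0 sin0 subr0 mul1r => E3.
have E4 : `|expR s - 1| <= e'.
  rewrite -(subrK s (expR s - 1)).
  apply: le_trans (ler_normD _ _) _.
  have : e' * `|s| <= `|s| by rewrite ler_piMl.
  lra.
have E5 : `|expR s| <= 2.
  have := ler_normD (expR s - 1) 1; rewrite subrK normr1; lra.
(* The two parts are at most 2 e' |t| + e' |s| and 3 e' |t|, and e' <= e / 6. *)
apply: le_trans (normc_le_ReIm _) _.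
rewrite /cexp /=.
have -> : expR s * cos t - 1 - s = expR s * (cos t - 1) + (expR s - 1 - s) by ring.
have -> : expR s * sin t - 0 - t = expR s * (sin t - t) + (expR s - 1) * t by ring.
have F1 : `|expR s * (cos t - 1)| <= 2 * (e' * `|t|) by rewrite normrM ler_pM.
have F2 : `|expR s * (sin t - t)| <= 2 * (e' * `|t|) by rewrite normrM ler_pM.
have F3 : `|(expR s - 1) * t| <= e' * `|t| by rewrite normrM ler_pM.
have G1 := ler_normD (expR s * (cos t - 1)) (expR s - 1 - s).
have G2 := ler_normD (expR s * (sin t - t)) ((expR s - 1) * t).
have G3 : e' * (`|s| + `|t|) <= e / 6 * (`|s| + `|t|) by rewrite ler_wpM2r// addr_ge0.
have G4 : 0 <= e' * `|s| by rewrite mulr_ge0// ltW.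
have G5 : 0 <= e' * `|t| by rewrite mulr_ge0// ltW.
lra.
Qed.

Lemma is_derive_cexp (z : R[i]^o) :
  is_derive z (1 : R[i]^o) (cexp : R[i]^o -> R[i]^o) (cexp z).
Proof.
apply/derivative_first_orderP => e /gt0_complexE[e0 ->].
set e1 := Re e in e0 *.
have c0 : 0 < 2 * (1 + normc (cexp z)) by rewrite mulr_gt0// ltr_pwDl// normc_ge0.
have [d d0 Hd] := cexp_first_order (divr_gt0 e0 c0).
exists d%:C; first by rewrite ltcR.
move=> h; rewrite !normr_normc ltcR => hd.
rewrite -rmorphM lecR cexpD.
have -> : cexp z * cexp h - cexp z - cexp z * h = cexp z * (cexp h - 1 - h) by ring.
rewrite Normc.normcM.
have hE : h = Re h +i* Im h by case: (h).
have := Hd (Re h) (Im h); rewrite -hE.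
move=> /(_ (le_lt_trans (normc_ge_Re _) hd) (le_lt_trans (normc_ge_Im _) hd)) H.
apply: le_trans (ler_wpM2l (normc_ge0 _) H) _.
have := normc_ge_Re h; have := normc_ge_Im h => I1 I2.
have : normc (cexp z) * (e1 / (2 * (1 + normc (cexp z))) * (`|Re h| + `|Im h|)) <=
   normc (cexp z) * (e1 / (2 * (1 + normc (cexp z))) * (2 * normc h)).
  rewrite ler_wpM2l ?normc_ge0// ler_wpM2l ?divr_ge0 ?(ltW e0) ?(ltW c0)//; lra.
move/le_trans; apply.
have -> : normc (cexp z) * (e1 / (2 * (1 + normc (cexp z))) * (2 * normc h)) =
   (normc (cexp z) / (1 + normc (cexp z))) * (e1 * normc h).
  by field; rewrite gt_eqF// ltr_pwDl// normc_ge0.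
rewrite ler_piMl// ?mulr_ge0 ?normc_ge0 ?(ltW e0)//.
by rewrite ler_pdivrMr ?mul1r ?lerDr// ltr_pwDl// normc_ge0.
Qed.

End complex_exponential.

Section mean_value.
Variable R : realType.
Local Open Scope complex_scope.
Local Notation normc := Normc.normc.
Local Notation Re := complex.Re.
Local Notation Im := complex.Im.
Local Notation mu := (@lebesgue_measure R).

(** The Cauchy-Riemann equations of g (e^(s + it)): if its derivative is
    u + iv, then P_s = Q_t = u, P_t = - v and Q_s = v. *)
Lemma closed_at_comp_cexp (g : R[i]^o -> R[i]^o) (s t : R) :
  differentiable g (cexp (s +i* t) : R[i]^o) ->
  closed_at (fun s t => Re (g (cexp (s +i* t)))) (fun s t => Im (g (cexp (s +i* t)))) s t.
Proof.
move=> dg.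
have dc : differentiable (@cexp R : R[i]^o -> R[i]^o) (s +i* t : R[i]^o).
  apply/derivable1_diffP.
  by case: (is_derive_cexp (s +i* t)).
have dgc : differentiable ((g \o @cexp R) : R[i]^o -> R[i]^o) (s +i* t : R[i]^o).
  exact: (@differentiable_comp _ _ _ _ _ _ _ dc dg).
move/derivable1_diffP/derivableP/derivative_first_orderP : dgc.
set k := derive _ _ _ => H.
exists (Re k), (- Im k), (Im k) => e e0.
have [|d /gt0_complexE[d0 dE] Hd] := H (e%:C); first by rewrite ltcR.
exists (Re d / 2); first by rewrite divr_gt0.
move=> s' t' hs ht.
have ht' : normc ((s' - s) +i* (t' - t)) <= `|s' - s| + `|t' - t|.
  exact: normc_le_ReIm.
have := Hd ((s' - s) +i* (t' - t)).
rewrite dE !normr_normc ltcR => /(_ (le_lt_trans ht' _)) => /=.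
have -> : s +i* t + ((s' - s) +i* (t' - t)) = s' +i* t'.
  by apply/eqP; rewrite eq_complex/=; apply/andP; split; apply/eqP; ring.
rewrite -rmorphM lecR => /(_ _)/le_trans Hd'.
have {}Hd' : normc (g (cexp (s' +i* t')) - g (cexp (s +i* t))
    - k * ((s' - s) +i* (t' - t))) <= e * (`|s' - s| + `|t' - t|).
  apply: Hd'; first by lra.
  by rewrite ler_wpM2l// ltW.
split.
  apply: le_trans Hd'; apply: le_trans (normc_ge_Re _).
  rewrite le_eqVlt; apply/orP; left; apply/eqP; congr (`|_|).
  by case: (g _) (g _) (k) => [a b] [c d'] [u v] /=; ring.
apply: le_trans Hd'; apply: le_trans (normc_ge_Im _).
rewrite le_eqVlt; apply/orP; left; apply/eqP; congr (`|_|).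
by case: (g _) (g _) (k) => [a b] [c d'] [u v] /=; ring.
Qed.

Lemma normc_cexp (s t : R) : normc (cexp (s +i* t)) = expR s.
Proof.
rewrite /cexp /= !exprMn -mulrDr cos2Dsin2 mulr1 sqrtr_sqr ger0_norm//.
Qed.

(** In logarithmic coordinates l = e^(s + it) the circles are vertical segments;
    the circulation around [s, 0] x [0, 2 pi] vanishes and its horizontal sides
    cancel, so all circles of radius e^s <= 1 give the same integral. For small
    radius it is close to 2 pi Re (g 0) by continuity of g at 0. *)
Lemma circle_mean_value (g : R[i]^o -> R[i]^o) :
  (forall l, normc l <= 1 -> differentiable g (l : R[i]^o)) ->
  \int[mu]_(t in `[0, pi *+ 2]) Re (g (cexp (0 +i* t))) = Re (g 0) * (pi *+ 2).
Proof.
move=> dg.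
pose P s t := Re (g (cexp (s +i* t))); pose Q s t := Im (g (cexp (s +i* t))).
have C s t : s <= 0 -> closed_at P Q s t.
  move=> s0; apply: closed_at_comp_cexp; apply: dg.
  by rewrite normc_cexp -expR0 ler_expR.
have pi2 : 0 <= pi *+ 2 :> R by rewrite mulrn_wge0// pi_ge0.
have same s : s <= 0 -> \int[mu]_(t in `[0, pi *+ 2]) P 0 t = \int[mu]_(t in `[0, pi *+ 2]) P s t.
  move=> s0; have := @goursat R P Q s 0 0 (pi *+ 2) s0 pi2.
  rewrite /circulation.
  have -> : (fun x => Q x (pi *+ 2)) = (fun x => Q x 0).
    apply/funext => x; rewrite /Q /cexp /=.
    by rewrite -[pi *+ 2]add0r cosD2pi sinD2pi.
  rewrite subrr subr0 => /(_ _)/eqP; rewrite subr_eq0 => /(_ _)/eqP; apply.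
  by move=> x y /andP[_ x0] _; exact: C.
apply/eqP; rewrite -subr_eq0 -normr_le0; apply/ler_addgt0Pr => e e0; rewrite add0r.
have pi20 : 0 < pi *+ 2 :> R by rewrite mulrn_wgt0// pi_gt0.
have e'0 : 0 < e / (pi *+ 2) by rewrite divr_gt0.
have cg : {for (0 : R[i]^o), continuous g}.
  by apply: differentiable_continuous; apply: dg; rewrite Normc.normc0 ler01.
move: cg => /cvgrPdist_le /(_ (e / (pi *+ 2))%:C); rewrite ltcR => /(_ e'0).
move=> /nbhs_normP[d /= /gt0_complexE[d0 dE] Hd].
(* e^s < d and s <= 0 *)
pose s := Num.min 0 (ln (Re d / 2)).
have s0 : s <= 0 by rewrite ge_min lexx.
rewrite (same s s0) -[pi *+ 2 in X in _ * X]subr0.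
rewrite -[leRHS](divfK (lt0r_neq0 pi20)) -[pi *+ 2 in leRHS]subr0.
apply: segment_integral_near_cst => // [x _|x _].
  exact: (closed_at_continuousP (C _ _ s0)).1.
have := Hd (cexp (s +i* x)); rewrite /= sub0r normrN dE normr_normc ltcR normc_cexp.
have hs : expR s < Re d.
  apply: (@le_lt_trans _ _ (Re d / 2)); last by lra.
  by rewrite -[leRHS]lnK ?posrE ?divr_gt0// ler_expR ge_min lexx orbT.
move=> /(_ hs); rewrite normr_normc lecR => h.
rewrite subr0; apply: le_trans h; apply: le_trans (normc_ge_Re _); rewrite distrC.
rewrite le_eqVlt; apply/orP; left; apply/eqP; congr (`|_|); rewrite /P.
by case: (g _) (g _) => [a b] [c d'].
Qed.

End mean_value.

(** * Geometry of the domain *)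

Lemma continuous_pairing (T U V : topologicalType) (f : T -> U) (g : T -> V) x :
  {for x, continuous f} -> {for x, continuous g} ->
  {for x, continuous (fun y => (f y, g y))}.
Proof. by move=> cf cg; exact: cvg_pair. Qed.

Section coordinates.
Variable R : realType.
Local Open Scope complex_scope.
Local Notation normc := (@Normc.normc R).
Local Notation Re := (@complex.Re R).
Local Notation Im := (@complex.Im R).

(** Radii of complex balls are themselves complex numbers, positive ones being
    real; this gives them as elements of [R]. *)
Lemma nbhs_complexP (z : R[i]^o) (P : set R[i]^o) :
  nbhs z P <-> exists2 d : R, 0 < d & forall w, normc (w - z) < d -> P w.
Proof.
split=> [/nbhs_normP[d /= /gt0_complexE[d0 dE] H]|[d d0 H]].
  exists (Re d) => // w wd; apply: H; rewrite /= distrC dE normr_normc ltcR.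
  exact: wd.
apply/(@nbhs_normP _ R[i]^o); exists (d%:C); first by rewrite /= ltcR.
move=> w /=; rewrite distrC normr_normc ltcR; exact: H.
Qed.

Lemma continuous_Re : continuous (Re : R[i]^o -> R).
Proof.
move=> z; apply/(@cvgrPdist_le _ R^o _ _ (nbhs_filter (z : R[i]^o))) => e e0.
apply/nbhs_complexP; exists e => // w wd.
have -> : Re z - Re w = Re (z - w) by case: (z) (w) => [? ?] [].
apply: le_trans (normc_ge_Re _) _.
by rewrite -normcN opprB ltW.
Qed.

Lemma continuous_Im : continuous (Im : R[i]^o -> R).
Proof.
move=> z; apply/(@cvgrPdist_le _ R^o _ _ (nbhs_filter (z : R[i]^o))) => e e0.
apply/nbhs_complexP; exists e => // w wd.
have -> : Im z - Im w = Im (z - w) by case: (z) (w) => [? ?] [].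
apply: le_trans (normc_ge_Im _) _.
by rewrite -normcN opprB ltW.
Qed.

Lemma continuous_normc : continuous (normc : R[i]^o -> R).
Proof.
move=> z; apply/(@cvgrPdist_le _ R^o _ _ (nbhs_filter (z : R[i]^o))) => e e0.
apply/nbhs_complexP; exists e => // w wd.
have h1 := le_normcD (z - w) w; have h2 := le_normcD (w - z) z.
rewrite !subrK in h1 h2; rewrite ler_norml; apply/andP; split; last first.
  by move: h1; rewrite -(opprB w z) normcN; lra.
lra.
Qed.

Definition complex_of_pair (p : R * R) : R[i]^o := p.1 +i* p.2.

Lemma continuous_complex_of_pair : continuous complex_of_pair.
Proof.
move=> p; apply/cvg_ballP => e /gt0_complexE[e0 eE].
have e20 : 0 < Re e / 2 by rewrite divr_gt0.
near=> q; rewrite /ball /= eE normr_normc ltcR.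
apply: le_lt_trans (normc_le_ReIm _) _ => /=.
have : `|p.1 - q.1| < Re e / 2.
  near: q; have : {for p, continuous (@fst R R)} by exact: cvg_fst.
  by move=> /cvgrPdist_lt; apply.
have : `|p.2 - q.2| < Re e / 2.
  near: q; have : {for p, continuous (@snd R R)} by exact: cvg_snd.
  by move=> /cvgrPdist_lt; apply.
lra.
Unshelve. all: by end_near. Qed.

Lemma continuous_toC2 : continuous (@toC2 R).
Proof.
move=> x; apply: (@continuous_pairing _ _ _ (complex_of_pair \o fst) (complex_of_pair \o snd)).
  by apply: continuous_comp; [exact: cvg_fst|exact: continuous_complex_of_pair].
by apply: continuous_comp; [exact: cvg_snd|exact: continuous_complex_of_pair].
Qed.

Definition ofC2 (z : C2 R) : R4 R := ((Re z.1, Im z.1), (Re z.2, Im z.2)).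

Lemma ofC2K : cancel ofC2 (@toC2 R).
Proof. by move=> [[a b] [c d]]. Qed.

Lemma continuous_ofC2 : continuous ofC2.
Proof.
have h (f : C2 R -> R[i]^o) (z : C2 R) : {for z, continuous f} ->
    {for z, continuous (fun z => (Re (f z), Im (f z)))}.
  move=> cf; apply: continuous_pairing.
    exact: (continuous_comp cf (@continuous_Re _)).
  exact: (continuous_comp cf (@continuous_Im _)).
move=> z; apply: (@continuous_pairing _ _ _ (fun z : C2 R => (Re z.1, Im z.1))
  (fun z : C2 R => (Re z.2, Im z.2))).
  by apply: h; exact: cvg_fst.
by apply: h; exact: cvg_snd.
Qed.

End coordinates.

Section polynomial_functions.
Variables (R : realType) (V : normedModType R).

(** Polynomial functions: a class closed under directional derivatives and
    consisting of differentiable functions, hence of smooth ones. *)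
Inductive polyfun : (V -> R) -> Prop :=
| polyfun_cst c : polyfun (cst c)
| polyfun_linear (l : {linear V -> R^o}) : continuous l -> polyfun l
| polyfun_add f g : polyfun f -> polyfun g -> polyfun (f + g)
| polyfun_mul f g : polyfun f -> polyfun g -> polyfun (f * g).

Lemma polyfun_differentiable f : polyfun f -> forall x, differentiable f x.
Proof.
elim=> {f} [c|l cl|f g _ df _ dg|f g _ df _ dg] x.
- exact: differentiable_cst.
- exact: linear_differentiable.
- exact: differentiableD.
- exact: differentiableM.
Qed.

Lemma polyfun_derive f v : polyfun f -> polyfun ('D_v f).
Proof.
elim=> {f} [c|l cl|f g pf df pg dg|f g pf df pg dg].
- have -> : 'D_v (cst c) = cst 0 :> (V -> R) by apply/funext => x; rewrite derive_cst.
  exact: polyfun_cst.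
- have -> : 'D_v l = cst (l v) :> (V -> R).
    by apply/funext => x; rewrite deriveE ?diff_lin//; exact: linear_differentiable.
  exact: polyfun_cst.
- have -> : 'D_v (f + g) = 'D_v f + 'D_v g :> (V -> R).
    by apply/funext => x; rewrite deriveD//; apply: diff_derivable; exact: polyfun_differentiable.
  exact: polyfun_add.
- have -> : 'D_v (f * g) = f * 'D_v g + g * 'D_v f :> (V -> R).
    by apply/funext => x; rewrite deriveM//; apply: diff_derivable; exact: polyfun_differentiable.
  by apply: polyfun_add; exact: polyfun_mul.
Qed.

Lemma polyfun_smooth f : polyfun f -> smooth_on setT f.
Proof.
move=> pf k; elim: k f pf => [|k IH] f pf /=; split => //.
- by move=> x _; apply: differentiable_continuous; exact: polyfun_differentiable.
- by move=> x _; apply: differentiable_continuous; exact: polyfun_differentiable.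
- move=> v; split; last by apply: IH; exact: polyfun_derive.
  by move=> x _; apply: diff_derivable; exact: polyfun_differentiable.
Qed.

End polynomial_functions.

Section quasi_ball.
Variable R : realType.
Local Open Scope complex_scope.
Local Notation normc := (@Normc.normc R).
Local Notation Re := (@complex.Re R).
Local Notation Im := (@complex.Im R).

(** The action with weights (1, 2), chosen so that z1^2 and z2 scale alike. *)
Definition weighted_act (l : R[i]) (z : C2 R) : C2 R := (l * z.1, l ^+ 2 * z.2).

Lemma differentiable_weighted_act (z : C2 R) (l : R[i]^o) :
  differentiable ((fun l => weighted_act l z) : R[i]^o -> C2 R) l.
Proof.
apply: (@differentiable_pair _ _ _ _ (fun l : R[i]^o => l * z.1 : R[i]^o)
  (fun l : R[i]^o => l ^+ 2 * z.2 : R[i]^o)).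
  by apply: differentiableM.
by apply: differentiableM => //; exact: differentiableX.
Qed.

Definition sqnormc (z : R[i]) : R := Re z ^+ 2 + Im z ^+ 2.

Lemma sqnormc_ge0 z : 0 <= sqnormc z.
Proof. by rewrite addr_ge0 ?sqr_ge0. Qed.

Lemma sqnormcE z : sqnormc z = normc z ^+ 2.
Proof. by case: z => a b; rewrite /sqnormc /= sqr_sqrtr// addr_ge0 ?sqr_ge0. Qed.

Lemma sqnormcM z w : sqnormc (z * w) = sqnormc z * sqnormc w.
Proof. by rewrite !sqnormcE Normc.normcM exprMn. Qed.

Definition defining_fun (z : C2 R) : R := sqnormc z.1 + sqnormc (z.2 - z.1 ^+ 2) - 1.

Definition quasi_ball : set (C2 R) := [set z | defining_fun z < 0].

Lemma defining_fun_weighted_act l z :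
  defining_fun (weighted_act l z) =
    sqnormc l * sqnormc z.1 + sqnormc l ^+ 2 * sqnormc (z.2 - z.1 ^+ 2) - 1.
Proof.
rewrite /defining_fun /weighted_act /= exprMn -mulrBr.
by rewrite !sqnormcM -expr2.
Qed.

Lemma quasi_ball_weighted_act l z : normc l <= 1 -> quasi_ball z -> quasi_ball (weighted_act l z).
Proof.
rewrite /quasi_ball /= defining_fun_weighted_act => l1; rewrite /defining_fun.
have l2 : sqnormc l <= 1 by rewrite sqnormcE expr_le1// normc_ge0.
have l4 : sqnormc l ^+ 2 <= 1 by rewrite expr_le1// sqnormc_ge0.
have := ler_piMl (sqnormc_ge0 z.1) l2.
have := ler_piMl (sqnormc_ge0 (z.2 - z.1 ^+ 2)) l4.
lra.
Qed.

(** [defining_fun] expanded in real coordinates, z1 = x11 + i x12 and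
    z2 = x21 + i x22. *)
Definition real_defining_fun (x : R4 R) : R :=
  x.1.1 ^+ 2 + x.1.2 ^+ 2 + (x.2.1 - (x.1.1 ^+ 2 - x.1.2 ^+ 2)) ^+ 2
  + (x.2.2 - 2 * x.1.1 * x.1.2) ^+ 2 - 1.

Lemma defining_funE x : defining_fun (toC2 x) = real_defining_fun x.
Proof.
by case: x => [[a b] [c d]]; rewrite /defining_fun /real_defining_fun /sqnormc /= ; ring.
Qed.

Lemma realify_quasi_ball : realify quasi_ball = [set x | real_defining_fun x < 0].
Proof. by apply/funext => x; rewrite /mkset -defining_funE. Qed.

Local Notation X1 := (fun x : R4 R => x.1.1).
Local Notation X2 := (fun x : R4 R => x.1.2).
Local Notation X3 := (fun x : R4 R => x.2.1).
Local Notation X4 := (fun x : R4 R => x.2.2).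

Lemma polyfun_X1 : polyfun (X1 : R4 R -> R).
Proof.
apply: (@polyfun_linear _ _ (fst \o fst : {linear R4 R -> R^o})) => x.
by apply: continuous_comp; exact: cvg_fst.
Qed.

Lemma polyfun_X2 : polyfun (X2 : R4 R -> R).
Proof.
apply: (@polyfun_linear _ _ (snd \o fst : {linear R4 R -> R^o})) => x.
by apply: continuous_comp; [exact: cvg_fst|exact: cvg_snd].
Qed.

Lemma polyfun_X3 : polyfun (X3 : R4 R -> R).
Proof.
apply: (@polyfun_linear _ _ (fst \o snd : {linear R4 R -> R^o})) => x.
by apply: continuous_comp; [exact: cvg_snd|exact: cvg_fst].
Qed.

Lemma polyfun_X4 : polyfun (X4 : R4 R -> R).
Proof.
apply: (@polyfun_linear _ _ (snd \o snd : {linear R4 R -> R^o})) => x.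
by apply: continuous_comp; [exact: cvg_snd|exact: cvg_snd].
Qed.

(** Signs are written as multiplications by constants so that the expression
    is built from the constructors of [polyfun] only. *)
Lemma real_defining_funE : real_defining_fun = X1 * X1 + X2 * X2
 + (X3 + (cst (-1) * (X1 * X1) + X2 * X2)) * (X3 + (cst (-1) * (X1 * X1) + X2 * X2))
 + (X4 + cst (-2) * (X1 * X2)) * (X4 + cst (-2) * (X1 * X2)) + cst (-1).
Proof. by apply/funext => x; rewrite /real_defining_fun /= !fctE /=; ring. Qed.

Lemma polyfun_real_defining_fun : polyfun real_defining_fun.
Proof.
rewrite real_defining_funE.
have H1 := polyfun_X1; have H2 := polyfun_X2; have H3 := polyfun_X3; have H4 := polyfun_X4.
by repeat first [exact: H1|exact: H2|exact: H3|exact: H4|exact: polyfun_cst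
  | apply: polyfun_add | apply: polyfun_mul].
Qed.

Lemma continuous_real_defining_fun : continuous real_defining_fun.
Proof.
move=> x; apply: differentiable_continuous.
exact: polyfun_differentiable polyfun_real_defining_fun x.
Qed.

Lemma open_realify_quasi_ball : open (realify quasi_ball).
Proof.
rewrite realify_quasi_ball.
apply: (@open_comp _ _ real_defining_fun [set y | y < 0]); last exact: open_lt.
by move=> x _; exact: continuous_real_defining_fun.
Qed.

Lemma open_quasi_ball : open quasi_ball.
Proof.
have -> : quasi_ball = @ofC2 R @^-1` realify quasi_ball.
  by apply/seteqP; split => z /=; rewrite /realify /= ofC2K.
apply: open_comp; last exact: open_realify_quasi_ball.
by move=> x _; exact: continuous_ofC2.
Qed.

Lemma weighted_act0 (z : C2 R) : weighted_act 0 z = 0.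
Proof. by rewrite /weighted_act expr2 !mul0r. Qed.

Lemma quasi_ball0 : quasi_ball (0 : C2 R).
Proof.
have s0 : sqnormc 0 = 0 by rewrite /sqnormc /= expr0n/= addr0.
rewrite /quasi_ball /mkset -(weighted_act0 0) defining_fun_weighted_act s0.
rewrite expr0n/= !mul0r addr0 sub0r.
exact: ltrN10.
Qed.

Lemma continuous_weighted_act (z : C2 R) :
  continuous ((fun l => weighted_act l z) : R[i]^o -> C2 R).
Proof. by move=> l; apply: differentiable_continuous; exact: differentiable_weighted_act. Qed.

Lemma weighted_act1 (z : C2 R) : weighted_act 1 z = z.
Proof. by rewrite /weighted_act expr1n !mul1r; case: z. Qed.

(** Every point is joined to 0 inside the set by its orbit under the dilations
    of factor t in [0, 1]. *)
Lemma connected_quasi_ball : connected quasi_ball.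
Proof.
have -> : quasi_ball = \bigcup_(z in quasi_ball)
    ((fun t : R => weighted_act (complex_of_pair (t, 0)) z) @` `[0, 1]).
  apply/seteqP; split => [z Oz|w [z Oz [t]]].
    exists z => //; exists 1; first by rewrite /= in_itv/= ler01 lexx.
    exact: weighted_act1.
  rewrite /= in_itv/= => /andP[t0 t1] <-; apply: quasi_ball_weighted_act => //.
  by rewrite /complex_of_pair /= expr0n/= addr0 sqrtr_sqr ger0_norm.
apply: bigcup_connected.
  exists 0 => z _; exists 0; first by rewrite /= in_itv/= lexx ler01.
  exact: weighted_act0.
move=> z _; apply: connected_continuous_connected.
  apply/connected_intervalP; exact: interval_is_interval.
apply: continuous_subspaceT => t.
have c1 : {for t, continuous (fun t : R => complex_of_pair (t, 0))}.
  apply: continuous_comp; last exact: continuous_complex_of_pair.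
  by apply: continuous_pairing; [exact: cvg_id|exact: cvg_cst].
exact: (continuous_comp c1 (@continuous_weighted_act z _)).
Qed.

(** At (3/4, 9/16) the second summand vanishes and the defining function is
    9/16 - 1; at the opposite point the second summand is (9/8)^2 > 1. *)
Lemma not_circular_quasi_ball : ~ circular quasi_ball.
Proof.
move=> /(_ ((3 / 4)%:C, (9 / 16)%:C) (- 1)).
rewrite normrN normr1 => h.
have : quasi_ball (- 1 *: (((3 / 4)%:C, (9 / 16)%:C) : C2 R)).
  apply: h => //; rewrite /quasi_ball /defining_fun /sqnormc /=; lra.
rewrite /quasi_ball /defining_fun /sqnormc /=; lra.
Qed.

End quasi_ball.

Section quasi_ball_geometry.
Variable R : realType.
Local Open Scope complex_scope.
Local Notation normc := (@Normc.normc R).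
Local Notation Re := (@complex.Re R).
Local Notation Im := (@complex.Im R).

(** The four squares are less than 1, and the real and imaginary parts of z1^2
    are at most |z1|^2 < 1. *)
Lemma quasi_ball_box (x : R4 R) : real_defining_fun x < 0 ->
  [/\ `|x.1.1| <= 3, `|x.1.2| <= 3, `|x.2.1| <= 3 & `|x.2.2| <= 3].
Proof.
case: x => [[a b] [c d]]; rewrite /real_defining_fun /= => h.
have small (u : R) : u ^+ 2 < 1 -> - 1 < u < 1.
  by move=> u1; rewrite -ltr_norml -(@expr_lt1 _ 2)// real_normK// num_real.
have [a2 b2] := (sqr_ge0 a, sqr_ge0 b).
have [p2 q2] := (sqr_ge0 (c - (a ^+ 2 - b ^+ 2)), sqr_ge0 (d - 2 * a * b)).
have /small/andP[? ?] : a ^+ 2 < 1 by lra.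
have /small/andP[? ?] : b ^+ 2 < 1 by lra.
have /small/andP[? ?] : (c - (a ^+ 2 - b ^+ 2)) ^+ 2 < 1 by lra.
have /small/andP[? ?] : (d - 2 * a * b) ^+ 2 < 1 by lra.
have ? := sqr_ge0 (a - b); have ? := sqr_ge0 (a + b).
have ab1 : 2 * a * b = (a + b) ^+ 2 - (a ^+ 2 + b ^+ 2) by ring.
have ab2 : 2 * a * b = a ^+ 2 + b ^+ 2 - (a - b) ^+ 2 by ring.
by split; rewrite ler_norml; apply/andP; split; lra.
Qed.

Lemma bounded_quasi_ball : bounded_set (@quasi_ball R).
Proof.
exists (6%:C); split; first by rewrite complex_real.
move=> M M6 z; rewrite /quasi_ball/= -(ofC2K z) defining_funE => /quasi_ball_box[h1 h2 h3 h4].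
have h u v : `|u| <= 3 -> `|v| <= 3 -> `|u +i* v| <= M.
  move=> u3 v3; apply: le_trans (ltW M6); rewrite normr_normc lecR.
  by apply: le_trans (normc_le_ReIm _) _ => /=; lra.
by rewrite prod_normE /Order.max /=; case: ifP => _; apply: h.
Qed.

Lemma volume_quasi_ball_fin : (lebesgue4 R (realify (@quasi_ball R)) < +oo)%E.
Proof.
pose I := `[(-3 : R), 3]%classic.
have mI : measurable (I : set (measurableTypeR R)) by exact: measurable_itv.
apply: (@le_lt_trans _ _ (lebesgue4 R ((I `*` I) `*` (I `*` I)))).
  apply: le_measure; rewrite ?inE.
  - exact: (open_measurable_R4 (@open_realify_quasi_ball R)).
  - by do !apply: measurableX.
  - rewrite realify_quasi_ball => x /quasi_ball_box[].
    by rewrite /I /= !in_itv/= !ler_norml => -> -> -> ->.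
have mII : measurable ((I `*` I) : set (measurableTypeR R * measurableTypeR R)).
  exact: measurableX.
have e2 : lebesgue2 R (I `*` I) = (@lebesgue_measure R I * @lebesgue_measure R I)%E.
  exact: (product_measure1E (@lebesgue_measure R) (@lebesgue_measure R) mI mI).
have -> : lebesgue4 R ((I `*` I) `*` (I `*` I)) =
    (lebesgue2 R (I `*` I) * lebesgue2 R (I `*` I))%E.
  exact: (product_measure1E (lebesgue2 R) (lebesgue2 R) mII mII).
rewrite e2.
rewrite lebesgue_measure_itv/= lte_fin.
by rewrite -!EFinD; case: ifP; rewrite -?EFinM ?mule0 ltry.
Qed.

(** The direction (z1, 2 z2) is the velocity of the dilations t . z at t = 1;
    along it the two summands grow at rates 2 |z1|^2 and 4 |z2 - z1^2|^2, as they
    scale by t^2 and t^4. *)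
Lemma derive_real_defining_fun (x : R4 R) :
  'D_((x.1.1, x.1.2), (2 * x.2.1, 2 * x.2.2)) (@real_defining_fun R) x =
  2 * (x.1.1 ^+ 2 + x.1.2 ^+ 2) +
  4 * ((x.2.1 - (x.1.1 ^+ 2 - x.1.2 ^+ 2)) ^+ 2 + (x.2.2 - 2 * x.1.1 * x.1.2) ^+ 2).
Proof.
set v := (_, _).
have dX (l : {linear R4 R -> R^o}) : continuous l -> is_derive x v l (l v).
  move=> cl; have dl := linear_differentiable x cl.
  by apply: DeriveDef; [exact: diff_derivable|rewrite deriveE// diff_lin].
have d1 : is_derive x v (fun x : R4 R => x.1.1) v.1.1.
  apply: (dX (fst \o fst : {linear R4 R -> R^o})) => y.
  by apply: continuous_comp; exact: cvg_fst.
have d2 : is_derive x v (fun x : R4 R => x.1.2) v.1.2.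
  apply: (dX (snd \o fst : {linear R4 R -> R^o})) => y.
  by apply: continuous_comp; [exact: cvg_fst|exact: cvg_snd].
have d3 : is_derive x v (fun x : R4 R => x.2.1) v.2.1.
  apply: (dX (fst \o snd : {linear R4 R -> R^o})) => y.
  by apply: continuous_comp; [exact: cvg_snd|exact: cvg_fst].
have d4 : is_derive x v (fun x : R4 R => x.2.2) v.2.2.
  apply: (dX (snd \o snd : {linear R4 R -> R^o})) => y.
  by apply: continuous_comp; exact: cvg_snd.
have p11 := is_deriveM d1 d1; have p22 := is_deriveM d2 d2.
have w3 := is_deriveD d3 (is_deriveD (is_deriveM (is_derive_cst (-1 : R) x v) p11) p22).
have w4 := is_deriveD d4 (is_deriveM (is_derive_cst (-2 : R) x v) (is_deriveM d1 d2)).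
have D := is_deriveD (is_deriveD (is_deriveD (is_deriveD p11 p22) (is_deriveM w3 w3))
  (is_deriveM w4 w4)) (is_derive_cst (-1 : R) x v).
rewrite real_defining_funE (@derive_val _ _ _ _ _ _ _ D).
by rewrite /v /= /GRing.scale /= !fctE/=; ring.
Qed.

(** The defining function vanishes on the boundary, and its derivative along
    the dilations is positive there by [derive_real_defining_fun], so one smooth
    function with nonzero differential suffices. *)
Lemma piecewise_smooth_quasi_ball : piecewise_smooth_boundary (realify (@quasi_ball R)).
Proof.
move=> x [clx nix].
have x0 : real_defining_fun x = 0.
  apply/eqP; rewrite eq_le; apply/andP; split.
    have cl : closed [set y : R4 R | real_defining_fun y <= 0].
      apply: (@closed_comp _ _ (@real_defining_fun R) [set y | y <= 0]); last exact: closed_le.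
      by move=> y _; exact: continuous_real_defining_fun.
    have : closure [set y : R4 R | real_defining_fun y <= 0] x.
      by apply: closure_subset clx; rewrite realify_quasi_ball => y /ltW.
    by rewrite -(closure_id _).1.
  rewrite leNgt; apply/negP => xlt; apply: nix.
  rewrite (interior_id _).1; last exact: open_realify_quasi_ball.
  by rewrite realify_quasi_ball.
exists setT, 1%N, (fun _ => @real_defining_fun R); split.
- by split => //; exact: openT.
- by move=> j; split => //; apply: polyfun_smooth; exact: polyfun_real_defining_fun.
- move=> c; pose v : R4 R := ((x.1.1, x.1.2), (2 * x.2.1, 2 * x.2.2)).
  move=> /(_ v); rewrite big_ord1 -deriveE; last first.
    exact: polyfun_differentiable (@polyfun_real_defining_fun R) x.
  rewrite derive_real_defining_fun => H j; rewrite ord1; move: H => /eqP.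
  rewrite mulf_eq0 => /orP[/eqP//|].
  have := sqr_ge0 (x.2.1 - (x.1.1 ^+ 2 - x.1.2 ^+ 2)).
  have := sqr_ge0 (x.2.2 - 2 * x.1.1 * x.1.2).
  by move: x0; rewrite /real_defining_fun => x0 P0 Q0 /eqP h; exfalso; lra.
- rewrite setIT realify_quasi_ball; apply/seteqP; split => y /=.
    by move=> ?; split.
  by move=> [_ /(_ ord0)].
Qed.

End quasi_ball_geometry.

(** * Averaging over the circle action *)

Section sub_mean_value.
Variable R : realType.
Local Open Scope complex_scope.
Local Notation normc := (@Normc.normc R).
Local Notation Re := (@complex.Re R).
Local Notation Im := (@complex.Im R).
Local Notation mR := (measurableTypeR R).
Local Notation mu := (@lebesgue_measure R).

(** Young's inequality for the product x * 1. *)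
Lemma bernoulli_powR (x p : R) : 0 <= x -> 1 <= p -> 1 + p * (x - 1) <= x `^ p.
Proof.
move=> x0; rewrite le_eqVlt => /predU1P[<-|p1]; first by rewrite powRr1//; lra.
have p0 : 0 < p by lra.
have p10 : 0 < p - 1 by lra.
have q0 : 0 < p / (p - 1) by rewrite divr_gt0.
have := @conjugate_powR R x 1 p (p / (p - 1)) x0 ler01 p0 q0.
rewrite mulr1 powR1 invf_div => /(_ _) H.
have {H} : x <= x `^ p / p + 1 * ((p - 1) / p).
  by apply: H; field; rewrite gt_eqF.
rewrite mul1r -mulrDl ler_pdivlMr//; lra.
Qed.

(** By [bernoulli_powR], |g|^p >= 1 + p (Re g - 1), and the right-hand side
    has mean 1 by [circle_mean_value]. *)
Lemma circle_sub_mean_value (g : R[i]^o -> R[i]^o) (p : R) : 1 <= p ->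
  (forall l, normc l <= 1 -> differentiable g (l : R[i]^o)) -> g 0 = 1 ->
  ((pi *+ 2)%:E <= \int[mu]_(t in `[0%R, (pi *+ 2)%R]) ((normc (g (cexp (0 +i* t)))) `^ p)%:E)%E.
Proof.
move=> p1 dg g0.
have pi2 : 0 < pi *+ 2 :> R by rewrite mulrn_wgt0// pi_gt0.
have cont (t : R) : {for t, continuous (fun t : R => g (cexp (0 +i* t)) : R[i]^o)}.
  have c1 : {for t, continuous (fun t : R => complex_of_pair (0, t))}.
    apply: continuous_comp; last exact: continuous_complex_of_pair.
    by apply: continuous_pairing; [exact: cvg_cst|exact: cvg_id].
  have c2 : {for complex_of_pair (0, t), continuous (@cexp R : R[i]^o -> R[i]^o)}.
    apply: differentiable_continuous; apply/derivable1_diffP.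
    by case: (is_derive_cexp (complex_of_pair (0, t))).
  have c3 : {for (cexp (complex_of_pair (0, t)) : R[i]^o), continuous g}.
    by apply: differentiable_continuous; apply: dg; rewrite normc_cexp expR0.
  exact: (continuous_comp (continuous_comp c1 c2) c3).
pose k (t : R) := normc (g (cexp (0 +i* t))) `^ p.
rewrite -[X in (_ <= X)%E]/(\int[mu]_(t in `[0%R, (pi *+ 2)%R]) (k t)%:E)%E.
have mk : measurable_fun setT (k : mR -> R).
  apply: (measurableT_comp (measurable_powR p)).
  apply: continuous_measurable_fun => t.
  exact: (continuous_comp (cont t) (@continuous_normc R _)).
have k0 t : 0 <= k t by exact: powR_ge0.
have mI : measurable (`[0%R, pi *+ 2]%classic : set mR) by exact: measurable_itv.
(* The Lebesgue integral is compared with that of a function of variable sign, so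
   [k] is first reduced to the integrable case. *)
have [kfin|] := ltP (\int[mu]_(t in `[0%R, (pi *+ 2)%R]) (k t)%:E)%E +oo%E; last first.
  by rewrite leye_eq => /eqP ->; exact: leey.
pose u t := Re (g (cexp (0 +i* t))).
have cu (t : R) : {for t, continuous u}.
  exact: (continuous_comp (cont t) (@continuous_Re R _)).
have iu : mu.-integrable `[0, pi *+ 2] (EFin \o u).
  by apply: segment_integrable => x _; exact: cu.
pose h t := (1 - p) + p * u t.
have ch (t : R) : {for t, continuous h}.
  apply: cvgD; first exact: cvg_cst.
  by apply: cvgM; [exact: cvg_cst|exact: cu].
have ih : mu.-integrable `[0, pi *+ 2] (EFin \o h).
  by apply: segment_integrable => x _; exact: ch.
have hk t : h t <= k t.
  apply: le_trans (bernoulli_powR (normc_ge0 _) p1).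
  have : u t <= normc (g (cexp (0 +i* t))) by exact: le_trans (ler_norm _) (normc_ge_Re _).
  move=> ut; have : p * u t <= p * normc (g (cexp (0 +i* t))) by rewrite ler_wpM2l//; lra.
  by rewrite /h; lra.
have Ih : \int[mu]_(t in `[0, pi *+ 2]) h t = pi *+ 2.
  rewrite /h RintegralD//; last 2 first.
  - by apply: segment_integrable => x _; exact: cvg_cst.
  - by apply: segment_integrable => x _; apply: cvgM; [exact: cvg_cst|exact: cu].
  rewrite RintegralZl// circle_mean_value// g0 Rintegral_cst//= lebesgue_measure_itv/= lte_fin pi2.
  by rewrite -EFinD /= subr0; ring.
have := integrable_fin_num mI ih.
move=> /fineK; rewrite -[fine _]/(\int[mu]_(t in `[0, pi *+ 2]) h t) Ih => ->.
apply: le_integral => //; last by move=> t _; rewrite lee_fin.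
apply/integrableP; split.
  by apply/measurable_EFinP; exact: measurable_funTS.
apply: le_lt_trans kfin; rewrite le_eqVlt; apply/orP; left; apply/eqP.
by apply: eq_integral => t _ /=; rewrite ger0_norm.
Qed.

End sub_mean_value.

Section circle_average.
Variable R : realType.
Local Open Scope complex_scope.
Local Notation normc := (@Normc.normc R).
Local Notation mR := (measurableTypeR R).
Local Notation mR4 := ((mR * mR) * (mR * mR))%type.
Local Notation mu := (@lebesgue_measure R).
Local Notation mu4 := (lebesgue4 R).

Definition weighted_rotation (t : R) (x : R4 R) : R4 R :=
  (rotation (cos t) (sin t) x.1,
   rotation (cos t ^+ 2 - sin t ^+ 2) (2 * cos t * sin t) x.2).

(** The angle doubles on the second factor because l^2 acts there. *)
Lemma toC2_weighted_rotation t x :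
  toC2 (weighted_rotation t x) = weighted_act (cexp (0 +i* t)) (toC2 x).
Proof.
case: x => [[a b] [c d]]; rewrite /toC2 /weighted_act /weighted_rotation /rotation.
rewrite /cexp /= expR0 !mul1r expr2.
by congr (_, _); apply/eqP; rewrite eq_complex /=; apply/andP; split; apply/eqP; ring.
Qed.

Lemma measurable_weighted_rotation :
  measurable_fun setT (fun z : mR * mR4 => weighted_rotation z.1 z.2 : mR4).
Proof.
have mc : measurable_fun setT (fun z : mR * mR4 => cos z.1).
  apply: (@measurableT_comp _ _ _ _ _ _ (@cos R : mR -> mR)) => //.
  by apply: continuous_measurable_fun; exact: continuous_cos.
have ms : measurable_fun setT (fun z : mR * mR4 => sin z.1).
  apply: (@measurableT_comp _ _ _ _ _ _ (@sin R : mR -> mR)) => //.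
  by apply: continuous_measurable_fun; exact: continuous_sin.
have m1 : measurable_fun setT (fun z : mR * mR4 => z.2.1.1).
  by do 2 (apply: (measurableT_comp measurable_fst)); exact: measurable_snd.
have m2 : measurable_fun setT (fun z : mR * mR4 => z.2.1.2).
  apply: (measurableT_comp measurable_snd); apply: (measurableT_comp measurable_fst).
  exact: measurable_snd.
have m3 : measurable_fun setT (fun z : mR * mR4 => z.2.2.1).
  apply: (measurableT_comp measurable_fst); apply: (measurableT_comp measurable_snd).
  exact: measurable_snd.
have m4 : measurable_fun setT (fun z : mR * mR4 => z.2.2.2).
  by do 2 (apply: (measurableT_comp measurable_snd)); exact: measurable_snd.
have mc2 : measurable_fun setT (fun z : mR * mR4 => cos z.1 ^+ 2 - sin z.1 ^+ 2).
  by apply: measurable_funB; exact: measurable_funX.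
have ms2 : measurable_fun setT (fun z : mR * mR4 => 2 * cos z.1 * sin z.1).
  by apply: measurable_funM => //; exact: measurable_funM.
apply: measurable_fun_pair; apply: measurable_fun_pair => /=.
- by apply: measurable_funB; exact: measurable_funM.
- by apply: measurable_funD; exact: measurable_funM.
- by apply: measurable_funB; exact: measurable_funM.
- by apply: measurable_funD; exact: measurable_funM.
Qed.

Lemma integral_weighted_rotation (t : R) (G : mR4 -> \bar R) :
  measurable_fun setT G -> (forall x, 0 <= G x)%E ->
  (\int[mu4]_x G (weighted_rotation t x) = \int[mu4]_x G x)%E.
Proof.
move=> mG G0; rewrite /weighted_rotation.
have h1 : cos t ^+ 2 + sin t ^+ 2 = 1 by rewrite cos2Dsin2.
have h2 : (cos t ^+ 2 - sin t ^+ 2) ^+ 2 + (2 * cos t * sin t) ^+ 2 = 1.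
  transitivity ((cos t ^+ 2 + sin t ^+ 2) ^+ 2); first by ring.
  by rewrite h1 expr1n.
exact: (integral_rotation2 h1 h2 mG G0).
Qed.

(** Each rotation leaves the integral of G unchanged, so k times this integral
    is the integral of G (R_t x) over t in [0, k] and x; integrating in t first
    gives at least k for every x in W. *)
Lemma circle_average_le (W : set mR4) (G : mR4 -> \bar R) (k : R) : 0 < k ->
  measurable W -> measurable_fun setT G -> (forall x, 0 <= G x)%E ->
  (forall x, W x -> k%:E <= \int[mu]_(t in `[0%R, k]) G (weighted_rotation t x))%E ->
  (mu4 W <= \int[mu4]_x G x)%E.
Proof.
move=> k0 mW mG G0 HW.
pose I : set mR := `[0%R, k]%classic.
have mI : measurable I by exact: measurable_itv.
have muI : mu I = k%:E.
  by rewrite /I lebesgue_measure_itv/= lte_fin k0 -EFinD subr0.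
pose F (z : mR * mR4) : \bar R := ((\1_I z.1 : R)%:E * G (weighted_rotation z.1 z.2))%E.
have mF : measurable_fun setT F.
  apply: emeasurable_funM.
    have m1I : measurable_fun setT (\1_I : mR -> R) by exact: measurable_indic.
    by apply/measurable_EFinP; exact: (measurableT_comp m1I measurable_fst).
  exact: (measurableT_comp mG measurable_weighted_rotation).
have F0 z : (0 <= F z)%E by rewrite mule_ge0// lee_fin.
have := fubini_tonelli (m1 := mu) (m2 := mu4) F mF F0.
have -> : (\int[mu]_t \int[mu4]_x F (t, x) = k%:E * \int[mu4]_x G x)%E.
  transitivity (\int[mu]_t ((\1_I t : R)%:E * \int[mu4]_x G x))%E.
    apply: eq_integral => t _; rewrite /F /= ge0_integralZl//.
    - by rewrite integral_weighted_rotation.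
    - exact: (measurableT_comp mG (measurable_fun_pair2 t measurable_weighted_rotation)).
  rewrite ge0_integralZr//; last 2 first.
  - by apply/measurable_EFinP; exact: measurable_indic.
  - exact: integral_ge0.
  by rewrite integral_indic// setIT; congr (_ * _)%E; exact: muI.
move=> E; have : (k%:E * mu4 W <= k%:E * \int[mu4]_x G x)%E; last first.
  by rewrite lee_pmul2l.
rewrite {}E; have -> : mu4 W = (\int[mu4]_x (\1_W x)%:E)%E.
  by have := integral_indic mu4 measurableT mW; rewrite setIT => ->.
have m1W : measurable_fun setT (fun x : mR4 => (\1_W x : R)%:E).
  by apply/measurable_EFinP; exact: measurable_indic.
have W0 (x : mR4) : (0 <= (\1_W x : R)%:E)%E by rewrite lee_fin.
have k0' : (0 <= k%:E)%E by rewrite lee_fin ltW.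
rewrite -(ge0_integralZl mu4 measurableT m1W (fun x _ => W0 x) k0').
apply: ge0_le_integral => //.
- by move=> x _; rewrite mule_ge0.
- exact: measurable_funeM.
- exact: measurable_fun_fubini_tonelli_G.
move=> x _; rewrite indicE; have [|] := boolP (x \in W); rewrite (inE, notin_setE) => Wx.
  rewrite mule1; apply: le_trans (HW x Wx) _.
  rewrite integral_mkcond; rewrite le_eqVlt; apply/orP; left; apply/eqP.
  apply: eq_integral => t _; rewrite /F /patch indicE.
  by case: ifP => _; rewrite ?mul1e ?mul0e.
rewrite mule0; apply: integral_ge0 => t _; exact: F0.
Qed.

Local Notation W := (realify (@quasi_ball R)).

(** The orbit of a point x of the domain under |l| <= 1 stays in the domain, so
    the one-variable inequality applies to l |-> f (l . x). *)
Lemma volume_le_integral_pow (f : C2 R -> R[i]^o) (p : R) : 1 <= p ->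
  holomorphic (@quasi_ball R) f -> f 0 = 1 ->
  (mu4 W <= integral_pow (@quasi_ball R) p f)%E.
Proof.
move=> p1 hf f0; rewrite /integral_pow integral_mkcond.
have mW : measurable (W : set mR4) := open_measurable_R4 (@open_realify_quasi_ball R).
set G := (X in (_ <= \int[_]_x X x)%E).
have G0 x : (0 <= G x)%E.
  by rewrite /G /patch; case: ifP => // _; rewrite lee_fin powR_ge0.
have mG : measurable_fun setT (G : mR4 -> \bar R).
  have mh : measurable_fun (W : set mR4) (fun x => normc (f (toC2 x)) `^ p).
    apply: (measurableT_comp (measurable_powR p)).
    apply: continuous_measurable_R4; first exact: open_realify_quasi_ball.
    move=> x Wx; have c1 : {for toC2 x, continuous f}.
      by apply: differentiable_continuous; exact: hf.
    exact: (continuous_comp (continuous_comp (@continuous_toC2 R x) c1) (@continuous_normc R _)).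
  have mhE : measurable_fun (W : set mR4) (fun x => (normc (f (toC2 x)) `^ p)%:E).
    exact/measurable_EFinP.
  exact: ((measurable_restrictT _ mW).1 mhE).
have pi2 : 0 < pi *+ 2 :> R by rewrite mulrn_wgt0// pi_gt0.
apply: (circle_average_le pi2) => // x Wx.
pose g (l : R[i]^o) : R[i]^o := f (weighted_act l (toC2 x)).
have dg l : normc l <= 1 -> differentiable g (l : R[i]^o).
  move=> l1; apply: (@differentiable_comp _ _ _ _ (fun l : R[i]^o => weighted_act l (toC2 x)) f).
    exact: differentiable_weighted_act.
  by apply: hf; exact: quasi_ball_weighted_act.
have g0 : g 0 = 1 by rewrite /g weighted_act0.
apply: le_trans (circle_sub_mean_value p1 dg g0) _.
rewrite le_eqVlt; apply/orP; left; apply/eqP; apply: eq_integral => t _.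
rewrite /G /patch mem_set ?toC2_weighted_rotation//.
rewrite /realify /= toC2_weighted_rotation.
by apply: quasi_ball_weighted_act => //; rewrite normc_cexp expR0.
Qed.

(** The constant function 1 attains the infimum, which is |Omega|^(1/p). *)
Lemma bergman_kernel_quasi_ball (p : R) : 1 <= p ->
  bergman_kernel (@quasi_ball R) p 0 = (volume (@quasi_ball R))^-1.
Proof.
move=> p1; have p0 : 0 < p by lra.
have vol0 : 0 <= volume (@quasi_ball R) by exact/fine_ge0/measure_ge0.
have vfin : mu4 W \is a fin_num.
  by rewrite ge0_fin_numE ?measure_ge0//; exact: volume_quasi_ball_fin.
have mW : measurable (W : set mR4) := open_measurable_R4 (@open_realify_quasi_ball R).
have I1 : integral_pow (@quasi_ball R) p (cst 1) = mu4 W.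
  rewrite /integral_pow; under eq_integral do rewrite /= expr1n expr0n/= addr0 sqrtr1 powR1.
  by rewrite integral_cst//= mul1e.
rewrite /bergman_kernel; set S := image _ _.
have S1 : S (volume (@quasi_ball R) `^ p^-1).
  exists (cst 1) => /=; last by rewrite /pnorm I1.
  split => //; split; first by move=> z _; exact: differentiable_cst.
  by rewrite I1; exact: volume_quasi_ball_fin.
have lbS x : S x -> volume (@quasi_ball R) `^ p^-1 <= x.
  move=> [f [[hf ffin] f0] <-]; rewrite /pnorm.
  have f_fin : integral_pow (@quasi_ball R) p f \is a fin_num.
    by rewrite ge0_fin_numE// integral_ge0// => ? _; rewrite lee_fin powR_ge0.
  have vf : volume (@quasi_ball R) <= fine (integral_pow (@quasi_ball R) p f).
    by apply: fine_le => //; exact: volume_le_integral_pow.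
  by apply: ge0_ler_powR => //; rewrite ?nnegrE ?invr_ge0 ?(ltW p0)// (le_trans vol0).
have -> : inf S = volume (@quasi_ball R) `^ p^-1.
  apply/eqP; rewrite eq_le; apply/andP; split.
    by apply: ge_inf => //; exists (volume (@quasi_ball R) `^ p^-1).
  by apply: lb_le_inf => //; exists (volume (@quasi_ball R) `^ p^-1).
by rewrite -powRrM mulrN mulVf ?gt_eqF// powR_inv1.
Qed.

End circle_average.

Theorem proposition1p13 (R : realType) :
  exists Omega : set (C2 R),
    [/\ domain Omega,
        bounded_set Omega /\ Omega (0 : C2 R),
        ~ circular Omega,
        piecewise_smooth_boundary (realify Omega) &
        forall p : R, 2 <= p -> bergman_kernel Omega p 0 = (volume Omega)^-1].
Proof.
exists (@quasi_ball R); split.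
- split; [exact: open_quasi_ball|exact: connected_quasi_ball|].
  by exists 0; exact: quasi_ball0.
- by split; [exact: bounded_quasi_ball|exact: quasi_ball0].
- exact: not_circular_quasi_ball.
- exact: piecewise_smooth_quasi_ball.
- by move=> p p2; apply: bergman_kernel_quasi_ball; lra.
Qed.
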